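(* Let $d,e>1$ and $w\ge 0$ be integers. The number of $d$-balanced partitions in a block (any block) of $e$-weight $w$ is $$\binom{w+\left\lfloor\frac{e-1}{d}\right\rfloor}{w}.$$
   Context: A partition $\lambda=(\lambda_1\ge\lambda_2\ge\dots\ge\lambda_\ell>0)$ has Young diagram $[\lambda]=\{(r,c):1\le r\le \ell,\ 1\le c\le\lambda_r\}$ and size $|\lambda|=\sum\lambda_j$; $\lambda'$ denotes the conjugate partition. For $(r,c)\in[\lambda]$ the arm length of the hook at $(r,c)$ is $a_{rc}(\lambda)=\lambda_r-c$ and its hook length is $h_{rc}(\lambda)=a_{rc}(\lambda)+(\lambda'_c-r)+1$. The partition $\lambda$ is $d$-balanced (with respect to $e$) if $d\mid a_{rc}(\lambda)$ for every node $(r,c)\in[\lambda]$ with $e\mid h_{rc}(\lambda)$. The $\beta$-set of $\lambda$ is $B_0(\lambda)=\{\lambda_j-j: j\ge 1\}$ (with $\lambda_j=0$ for $j>\ell$). The $e$-core of $\lambda$ is the partition whose $\beta$-set is obtained from $B_0(\lambda)$ by repeatedly replacing an element $b$ by $b-e$ whenever $b-e$ is not in the set, until this is no longer possible (equivalently, by removing rim hooks of length $e$ until none remain). The $e$-weight of $\lambda$ is $(|\lambda|-|\gamma|)/e$, where $\gamma$ is the $e$-core of $\lambda$. A block is the set of all partitions with a given $e$-core $\gamma$ (a partition equal to its own $e$-core) and a given $e$-weight $w\geq 0$. *)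

(* Defs.v *)
From Stdlib Require Import Relation_Operators.
From HB Require Import structures.
From mathcomp Require Import all_boot all_order all_algebra.
From mathcomp Require Import boolp classical_sets functions cardinality.

Set Implicit Arguments.
Unset Strict Implicit.
Unset Printing Implicit Defensive.

Import Order.TTheory GRing.Theory Num.Theory.

Local Open Scope classical_set_scope.
Local Open Scope nat_scope.

Definition is_intpart (s : seq nat) : bool := sorted geq s && all (leq 1) s.

Record intpart := IntPart { parts :> seq nat; _ : is_intpart parts }.

HB.instance Definition _ := [isSub for parts].
HB.instance Definition _ := [Choice of intpart by <:].

Section Partitions.
Implicit Types (la ga : intpart) (r c d e w : nat).

Definition psize la : nat := sumn la.

(* Rows and columns are numbered from 1; [part la j] is 0 beyond the last row
   and is only meaningful for [0 < j]. *)
Definition part la j : nat := nth 0 la j.-1.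

(* The c-th part of the conjugate partition, for [0 < c]. *)
Definition conj_part la c : nat := count (leq c) la.

Definition node la r c : bool := (0 < r <= size la) && (0 < c <= part la r).

(* On nodes of [la] the subtractions below are not truncated. *)
Definition arm la r c : nat := part la r - c.

Definition hook la r c : nat := arm la r c + (conj_part la c - r) + 1.

Definition balanced d e la : Prop :=
  forall r c, node la r c -> e %| hook la r c -> d %| arm la r c.

Definition beta_set la : set int :=
  [set b | exists2 j, 0 < j & b = ((part la j)%:Z - j%:Z)%R].

Definition bead_move e (X Y : set int) : Prop :=
  exists b : int, [/\ X b, ~ X (b - e%:Z)%R & Y = (b - e%:Z)%R |` (X `\ b)].

Definition is_ecore_of e la ga : Prop :=
  clos_refl_trans (set int) (bead_move e) (beta_set la) (beta_set ga) /\
  forall Y, ~ bead_move e (beta_set ga) Y.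

Definition is_ecore e ga : Prop := is_ecore_of e ga ga.

(* The weight (|la| - |ga|) / e is an exact quotient, so it is specified by
   multiplying out. *)
Definition block e ga w : set intpart :=
  [set la | is_ecore_of e la ga /\ psize la = psize ga + w * e].

End Partitions.

(* Main.v *)
(* Encode a partition by its beta-set X.  If f counts the elements of the complement of X
   (the gaps), then nodes with e | hook are the pairs of a bead b and a gap c < b with
   e | b - c, and d-balance says f b = f c + 1 mod d for all of them.

   The number of balanced partitions of weight w is the same in all blocks.  Exchange
   runners a and a + 1: on the positions x = a mod e where exactly one of x, x + 1 is a bead,
   call x addable if x is the bead and removable otherwise.  Given the other positions,
   balance only requires that every addable x precede every removable y in a relation
   depending on f mod d alone.  That relation is asymmetric, so there is at most one
   balanced set with a prescribed number of addable positions, and moving an extremal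
   position from one class to the other reaches the number exchanged by the reflection.
   Reflections lower any core to the empty one.

   In a block whose runners are far apart compared with w, a balanced abacus has on each
   runner r at most one gap below its last bead, and none unless d | r; the depths of these
   gaps are floor((e-1)/d) + 1 arbitrary naturals with sum w. *)

Require Import Defs.
From Stdlib Require Import Relation_Operators.
From mathcomp Require Import all_boot all_order all_algebra.
From mathcomp Require Import boolp classical_sets functions cardinality fsbigop.
From mathcomp Require Import zify ring.

Set Implicit Arguments.
Unset Strict Implicit.
Unset Printing Implicit Defensive.

Import Order.TTheory GRing.Theory Num.Theory.
Local Open Scope classical_set_scope.
Local Open Scope card_scope.
Local Open Scope ring_scope.

Implicit Types (X Y Z G : set int) (u v f : int -> int) (x y b c r : int).
Implicit Types (la mu : intpart).

(** * Maya diagrams and their relative sums *)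

Definition ind X x : int := (x \in X)%:Z.

Lemma ind1 X x : X x -> ind X x = 1.
Proof. by move=> Xx; rewrite /ind mem_set. Qed.

Lemma ind0 X x : ~ X x -> ind X x = 0.
Proof. by move=> Xx; rewrite /ind memNset. Qed.

Variant ind_spec X x : int -> Prop :=
| IndIn of X x : ind_spec X x 1
| IndOut of ~ X x : ind_spec X x 0.

Lemma indP X x : ind_spec X x (ind X x).
Proof.
have [Xx|nXx] := pselect (X x); first by rewrite ind1//; constructor.
by rewrite ind0//; constructor.
Qed.

Lemma ind_iff X Y x y : (X x <-> Y y) -> ind X x = ind Y y.
Proof. by case: indP; case: indP; tauto. Qed.

Lemma eq_ind_set X Y : (forall x, ind X x = ind Y x) -> X = Y.
Proof.
move=> XY; apply/seteqP; split=> x; have := XY x;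
  by case: indP; case: indP.
Qed.

Definition bounded_by (K : nat) X :=
  forall x, (x < - K%:Z -> X x) /\ (K%:Z <= x -> ~ X x).

(** The sets that agree with the negative integers outside a finite window. Those with as many
    nonnegative elements as missing negative integers turn out to be exactly the beta-sets. *)
Definition maya X := exists K, bounded_by K X.

Lemma bounded_by_leq K L X : (K <= L)%N -> bounded_by K X -> bounded_by L X.
Proof. by move=> KL XK x; have [h1 h2] := XK x; split=> h; [apply: h1|apply: h2]; lia. Qed.

Lemma maya2 X Y : maya X -> maya Y -> exists K, bounded_by K X /\ bounded_by K Y.
Proof.
move=> [K XK] [L YL]; exists (maxn K L).
by split; [apply: bounded_by_leq XK|apply: bounded_by_leq YL]; lia.
Qed.

(* An infinite support would give the junk value 0, hence the [maya] hypotheses below. *)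
Definition excess u X Y : int := \sum_(x \in [set: int]) u x * (ind X x - ind Y x).

Lemma excess_seq s u X Y : uniq s -> (forall x, x \notin s -> ind X x = ind Y x) ->
  excess u X Y = \sum_(x <- s) u x * (ind X x - ind Y x).
Proof.
move=> us XY; rewrite /excess (fsbigE s)//=; last first.
  by move=> x _ /XY ->; rewrite subrr mulr0.
by apply: eq_bigl => x; rewrite in_setT.
Qed.

Definition window (K : nat) : seq int := [seq i%:Z - K%:Z | i <- iota 0 K.*2].

Lemma window_uniq K : uniq (window K).
Proof. by rewrite map_inj_uniq ?iota_uniq// => i j; lia. Qed.

Lemma mem_window K x : (x \in window K) = (- K%:Z <= x < K%:Z).
Proof.
apply/mapP/idP => [[i]|xK]; first by rewrite mem_iota => iK ->; lia.
by exists (absz (x + K%:Z)); rewrite ?mem_iota; lia.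
Qed.

Lemma excess_window K u X Y : bounded_by K X -> bounded_by K Y ->
  excess u X Y = \sum_(x <- window K) u x * (ind X x - ind Y x).
Proof.
move=> XK YK; apply: excess_seq (window_uniq K) _ => x.
rewrite mem_window => xK; have [X1 X2] := XK x; have [Y1 Y2] := YK x.
have [xl|xg] : x < - K%:Z \/ K%:Z <= x by lia.
  by rewrite !ind1; auto.
by rewrite !ind0; auto.
Qed.

Lemma eq_excess u v X Y : (forall x, ind X x <> ind Y x -> u x = v x) ->
  excess u X Y = excess v X Y.
Proof.
move=> uv; apply: eq_fsbigr => x _.
by have [->|/eqP/uv ->//] := eqVneq (ind X x) (ind Y x); rewrite subrr !mulr0.
Qed.

Lemma excessxx u X : excess u X X = 0.
Proof. by apply: fsbig1 => x _; rewrite subrr mulr0. Qed.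

Lemma excess_trans u X Y Z : maya X -> maya Y -> maya Z ->
  excess u X Y + excess u Y Z = excess u X Z.
Proof.
move=> mX mY [L ZL]; have [K [XK YK]] := maya2 mX mY.
have K1 : (K <= maxn K L)%N by lia.
have K2 : (L <= maxn K L)%N by lia.
rewrite !(@excess_window (maxn K L))//; try exact: (bounded_by_leq K1);
  try exact: (bounded_by_leq K2).
by rewrite -big_split/=; apply: eq_bigr => x _; ring.
Qed.

Lemma excessC u X Y : maya X -> maya Y -> excess u Y X = - excess u X Y.
Proof.
by move=> mX mY; have := excess_trans u mY mX mY; rewrite excessxx; lia.
Qed.

Lemma excessD u v X Y : maya X -> maya Y ->
  excess (fun x => u x + v x) X Y = excess u X Y + excess v X Y.
Proof.
move=> mX mY; have [K [XK YK]] := maya2 mX mY.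
rewrite !(excess_window _ XK YK) -big_split/=.
by apply: eq_bigr => x _; ring.
Qed.

Lemma excessZ (k : int) u X Y : maya X -> maya Y ->
  excess (fun x => k * u x) X Y = k * excess u X Y.
Proof.
move=> mX mY; have [K [XK YK]] := maya2 mX mY.
rewrite !(excess_window _ XK YK) mulr_sumr.
by apply: eq_bigr => x _; ring.
Qed.

Lemma excess_sum (n : nat) (F : nat -> int -> int) X Y : maya X -> maya Y ->
  excess (fun x => \sum_(i < n) F i x) X Y = \sum_(i < n) excess (F i) X Y.
Proof.
move=> mX mY; have [K [XK YK]] := maya2 mX mY.
rewrite (excess_window _ XK YK); under [RHS]eq_bigr do rewrite (excess_window _ XK YK).
rewrite exchange_big/=; apply: eq_bigr => x _.
by rewrite mulr_suml.
Qed.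

Lemma excess_ge0 u X Y : (forall x, 0 <= u x * (ind X x - ind Y x)) -> 0 <= excess u X Y.
Proof. by move=> h; apply: fsumr_ge0. Qed.

Lemma excess_ge u X Y x : maya X -> maya Y ->
  (forall x, 0 <= u x * (ind X x - ind Y x)) ->
  u x * (ind X x - ind Y x) <= excess u X Y.
Proof.
move=> mX mY h; have [K [XK YK]] := maya2 mX mY.
have KL : (K <= K + (absz x).+1)%N by lia.
rewrite (excess_window u (bounded_by_leq KL XK) (bounded_by_leq KL YK)).
rewrite (bigD1_seq x) ?window_uniq ?mem_window//=; last by lia.
by rewrite lerDl; apply: sumr_ge0.
Qed.

(** Evaluates the effect of moving beads from [q i] to [p i]. The two families may overlap;
    coincidences cancel because the terms are treated one by one. *)
Lemma excess_delta (n : nat) (p q : nat -> int) u X Y :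
  (forall x, ind X x - ind Y x = \sum_(i < n) ((x == p i)%:Z - (x == q i)%:Z)) ->
  excess u X Y = \sum_(i < n) (u (p i) - u (q i)).
Proof.
move=> XY.
pose s := undup ([seq p i | i <- iota 0 n] ++ [seq q i | i <- iota 0 n]).
have ps (i : 'I_n) : p i \in s.
  rewrite mem_undup mem_cat; apply/orP; left; apply/mapP; exists (nat_of_ord i) => //.
  by rewrite mem_iota/= ltn_ord.
have qs (i : 'I_n) : q i \in s.
  rewrite mem_undup mem_cat; apply/orP; right; apply/mapP; exists (nat_of_ord i) => //.
  by rewrite mem_iota/= ltn_ord.
rewrite (@excess_seq s) ?undup_uniq//; last first.
  move=> x xs; apply/eqP; rewrite -subr_eq0 XY big1// => i _.
  have -> : x == p i = false by apply: contraNF xs => /eqP ->.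
  by have -> : x == q i = false by apply: contraNF xs => /eqP ->.
under eq_bigr do rewrite XY mulr_sumr.
rewrite exchange_big/=; apply: eq_bigr => i _.
have one t : t \in s -> \sum_(x <- s) u x * (x == t)%:Z = u t.
  move=> ts; rewrite (bigD1_seq t) ?undup_uniq//= eqxx mulr1 big1 ?addr0//.
  by move=> x /negPf ->; rewrite mulr0.
under eq_bigr do rewrite mulrBr.
by rewrite sumrB !one.
Qed.

(** * Gap counts and balance *)

(** A discrete antiderivative of the indicator of the gaps. It is unique up to a constant and only
    its differences matter, so no normalisation is fixed. *)
Definition gap_count X f := forall x, f (x + 1) = f x + (1 - ind X x).

Lemma gap_count_ex X : exists f, gap_count X f.
Proof.
exists (fun x => match x with
  | Posz n => \sum_(i < n) (1 - ind X i%:Z)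
  | Negz n => - \sum_(i < n.+1) (1 - ind X (Negz i)) end).
case=> [n|[|n]].
- have -> : n%:Z + 1 = n.+1 by lia.
  by rewrite big_ord_recr.
- have -> : Negz 0 + 1 = Posz 0 by [].
  by rewrite /= big_ord0 big_ord1 addNr.
- have -> : Negz n.+1 + 1 = Negz n by rewrite !NegzE; lia.
  by rewrite [in RHS]big_ord_recr/= opprD subrK.
Qed.

Lemma gap_count_inj X f g : gap_count X f -> gap_count X g ->
  forall x, f x - g x = f 0 - g 0.
Proof.
move=> fX gX; elim/int_ind => [|n IH|n IH]; first by [].
  have -> : n.+1%:Z = n%:Z + 1 by lia.
  by rewrite fX gX; lia.
have E : - n%:Z = - n.+1%:Z + 1 by lia.
by move: IH; rewrite E fX gX; lia.
Qed.

(** From [c] to [b] the gap count grows by the number of gaps in between, [c] included; hence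
    [f b - f c - 1] counts the gaps strictly between them, which is the arm length. *)
Definition bal (d e : nat) X := forall f, gap_count X f -> forall b c,
  X b -> ~ X c -> c < b -> (e %| b - c)%Z -> (d %| f b - f c - 1)%Z.

Lemma balP (d e : nat) X f : gap_count X f ->
  (forall b c, X b -> ~ X c -> c < b -> (e %| b - c)%Z -> (d %| f b - f c - 1)%Z) ->
  bal d e X.
Proof.
move=> fX H g gX b c Xb Xc cb ebc; have := H b c Xb Xc cb ebc.
have := gap_count_inj gX fX b; have := gap_count_inj gX fX c.
by move=> h1 h2; have -> : g b - g c - 1 = f b - f c - 1 by lia.
Qed.

(** What balance asks of an addable [x] and a removable [y]: for [x < y] it comes from the bead
    [y + 1] and the gap [x + 1], for [y < x] from the bead [x] and the gap [y]. *)
Definition prec (d : nat) v x y : Prop :=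
  (x < y /\ (d %| v y - v x)%Z) \/ (y < x /\ (d %| v x - v y - 1)%Z).

Definition addable X x := X x /\ ~ X (x + 1).
Definition removable X x := ~ X x /\ X (x + 1).

Lemma dvdz_eqr (k s t : int) : (k %| s)%Z -> s = t -> (k %| t)%Z.
Proof. by move=> h <-. Qed.

Lemma dvdz_gt1 (n : nat) (k : int) : (1 < n)%N -> (n%:Z %| k)%Z -> (n%:Z %| k - 1)%Z -> False.
Proof.
move=> n1 h1 h2; have : (n%:Z %| k - (k - 1))%Z by apply: rpredB.
have -> : k - (k - 1) = 1 by lia.
by rewrite dvdz1 /=; lia.
Qed.

(** * Balance relative to two adjacent runners *)

Section Swap.
Variables (e : nat) (a : int).

Local Notation on x := (e%:Z %| x - a)%Z.

Lemma on_congr x y : (e%:Z %| x - y)%Z -> on x = on y.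
Proof.
move=> h; apply/idP/idP => h'.
  have -> : y - a = (x - a) - (x - y) by lia.
  by apply: rpredB.
have -> : x - a = (x - y) + (y - a) by lia.
by apply: rpredD.
Qed.

Lemma on_sub x y : on x -> on y -> (e%:Z %| x - y)%Z.
Proof. by move=> h h'; apply: dvdz_eqr (rpredB h h') _; lia. Qed.

Hypothesis e_gt1 : (1 < e)%N.

Lemma on_pred x : on x -> ~~ on (x - 1).
Proof.
move=> h; apply/negP => h'; apply: (@dvdz_gt1 e (x - a)) => //.
by have -> : x - a - 1 = x - 1 - a by lia.
Qed.

Lemma on_succ x : on x -> ~~ on (x + 1).
Proof. by move=> h; apply/negP => /on_pred; rewrite addrK h. Qed.

Variable d : nat.
Hypothesis d_gt1 : (1 < d)%N.

(* The part of balance that is insensitive to exchanging a position where exactly one of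
   [x], [x + 1] is a bead with the opposite configuration. *)
Definition calm X f :=
  (forall b c, X b -> ~ X c -> c < b -> (e %| b - c)%Z -> ~~ on c -> ~~ on (c - 1) ->
     (d %| f b - f c - 1)%Z) /\
  (forall x y, x < y -> on x -> on y ->
    [/\ ind X y + ind X (y + 1) = 2 -> ind X x + ind X (x + 1) = 0 -> False,
        ind X y + ind X (y + 1) = 2 -> ind X x + ind X (x + 1) = 1 -> (d %| f y - f x - 1)%Z
      & ind X y + ind X (y + 1) = 1 -> ind X x + ind X (x + 1) = 0 -> (d %| f y - f x - 1)%Z]).

Definition well_ordered X v :=
  forall i j, on i -> on j -> addable X i -> removable X j -> prec d v i j.

Lemma bal_calm X f : gap_count X f -> bal d e X -> calm X f /\ well_ordered X f.
Proof.
move=> fX /(_ f fX) bX; split; first split.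
- by move=> *; apply: bX.
- move=> x y xy ox oy.
  have H0 : X y -> ~ X x -> (d %| f y - f x - 1)%Z.
    by move=> Xy Xx; apply: bX => //; apply: on_sub.
  have H1 : X (y + 1) -> ~ X (x + 1) ->
      (d %| (f y + (1 - ind X y)) - (f x + (1 - ind X x)) - 1)%Z.
    move=> Xy Xx; rewrite -!fX; apply: bX => //; first by lia.
    have -> : y + 1 - (x + 1) = y - x by lia.
    by apply: on_sub.
  move: H0 H1.
  case: (indP X x) => Xx; case: (indP X (x + 1)) => Xx1; case: (indP X y) => Xy;
  case: (indP X (y + 1)) => Xy1 H0 H1; split=> //; try lia; try by move=> _ _; exact: H0.
  + by move=> _ _; apply: dvdz_eqr (H1 Xy1 Xx1) _; lia.
  (* Beads at [y], [y + 1] above gaps at [x], [x + 1] would make two consecutive integers divisible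
     by [d]. *)
  + move=> _ _; apply: (@dvdz_gt1 d (f y - f x - 1)) => //; first exact: H0.
    by apply: dvdz_eqr (H1 Xy1 Xx1) _; lia.
  + by move=> _ _; apply: dvdz_eqr (H1 Xy1 Xx1) _; lia.
- move=> i j oi oj [Xi Xi1] [Xj Xj1].
  have [ij|ji|E] := ltgtP i j; last by rewrite E in Xi.
  + left; split=> //.
    have : (d %| f (j + 1) - f (i + 1) - 1)%Z.
      apply: bX => //; first lia.
      have -> : j + 1 - (i + 1) = j - i by lia.
      by apply: on_sub.
    by rewrite !fX (ind1 Xi) (ind0 Xj) => h; apply: dvdz_eqr h _; lia.
  + by right; split=> //; apply: bX => //; apply: on_sub.
Qed.

(** A bead and a gap on a common runner lie on runner [a], on runner [a + 1], or on neither. The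
    last case is the first half of [calm]; in the others the contents of [x], [x + 1], [y], [y + 1]
    decide whether [calm] or [well_ordered] supplies the divisibility. *)
Lemma calm_bal X f : gap_count X f -> calm X f -> well_ordered X f -> bal d e X.
Proof.
move=> fX [C1 C2] W; apply: (balP fX) => b c Xb Xc cb ebc.
have key x y : x < y -> on x -> on y ->
    (X y -> ~ X x -> (d %| f y - f x - 1)%Z) /\
    (X (y + 1) -> ~ X (x + 1) ->
      (d %| (f y + (1 - ind X y)) - (f x + (1 - ind X x)) - 1)%Z).
  move=> xy ox oy; have := C2 x y xy ox oy; have := W x y ox oy; have := W y x oy ox.
  rewrite /addable /removable /prec.
  case: (indP X x) => Xx; case: (indP X (x + 1)) => Xx1; case: (indP X y) => Xy;
  case: (indP X (y + 1)) => Xy1 W1 W2 [c1 c2 c3]; split=> // _ _.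
  - by rewrite (_ : f y + (1 - 1) - (f x + (1 - 1)) - 1 = f y - f x - 1); [apply: c2|lia].
  - rewrite (_ : f y + (1 - 0) - (f x + (1 - 1)) - 1 = f y - f x); last by lia.
    have [[_ h]|[h _]] : _ \/ _ := W2 (conj Xx Xx1) (conj Xy Xy1); first exact: h.
    lia.
  - exact: c2.
  - have [[h _]|[_ h]] : _ \/ _ := W1 (conj Xy Xy1) (conj Xx Xx1); last exact: h.
    lia.
  - by have := c1 erefl erefl.
  - by have := c1 erefl erefl.
  - exact: c3.
  - by rewrite (_ : f y + (1 - 0) - (f x + (1 - 0)) - 1 = f y - f x - 1); [apply: c3|lia].
have [oc|noc] := boolP (on c).
  by apply: (key c b _ _ _).1 => //; rewrite (on_congr ebc).
have [oc1|noc1] := boolP (on (c - 1)); last exact: C1.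
have ob1 : on (b - 1).
  by rewrite (@on_congr _ (c - 1))//; have -> : b - 1 - (c - 1) = b - c by lia.
have c1b1 : c - 1 < b - 1 by lia.
have := (key _ _ c1b1 oc1 ob1).2; rewrite !subrK -!fX !subrK.
exact.
Qed.
End Swap.

(** * Exchanging two adjacent runners *)

Lemma int_has_min (P : int -> Prop) (L x0 : int) : P x0 -> (forall x, P x -> L <= x) ->
  exists2 m, P m & forall x, P x -> m <= x.
Proof.
move=> Px0 PL.
have ex : exists n : nat, `[< P (L + n%:Z) >].
  exists (absz (x0 - L)); apply/asboolP.
  by have := PL _ Px0 => h; have -> : L + (absz (x0 - L))%:Z = x0 by lia.
case: (ex_minnP ex) => n /asboolP Pn nmin; exists (L + n%:Z) => // x Px.
have Lx := PL _ Px; have := nmin (absz (x - L)) => h.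
suff : (n <= absz (x - L))%N by lia.
apply: h; apply/asboolP.
by have -> : L + (absz (x - L))%:Z = x by lia.
Qed.

Lemma prec_asym (d : nat) v x y : (1 < d)%N -> prec d v x y -> prec d v y x -> False.
Proof.
move=> d1 [[xy h]|[yx h]] [[yx' h']|[xy' h']]; try lia.
- exact: (dvdz_gt1 d1 h h').
- exact: (dvdz_gt1 d1 h' h).
Qed.

(** The order is cyclic in nature: starting from [i0] go upwards, then wrap around to the bottom. So
    [m] is the least element of [P] above [i0] if there is one, and otherwise the least element of
    [P]. *)
Lemma prec_min (d : nat) v (P : int -> Prop) (L i0 j0 : int) : P j0 ->
  (forall x, P x -> L <= x) -> (forall j, P j -> prec d v i0 j) ->
  exists2 m, P m & forall j, P j -> j <> m -> prec d v m j.
Proof.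
move=> Pj0 PL Pi0.
have [[j1 [Pj1 ij1]]|no] := pselect (exists j, P j /\ i0 < j).
  have [||m [Pm im] mmin] := @int_has_min (fun j => P j /\ i0 < j) L j1 => //.
    by move=> x [/PL].
  exists m => // j Pj jm.
  have [[_ hm]|[? _]] := Pi0 _ Pm; last lia.
  have [[ij hj]|[ji hj]] := Pi0 _ Pj.
    left; split; first by have := mmin j (conj Pj ij); lia.
    by apply: dvdz_eqr (rpredB hj hm) _; lia.
  right; split; first lia.
  by apply: dvdz_eqr (rpredD hj hm) _; lia.
have [m Pm mmin] := int_has_min Pj0 PL.
exists m => // j Pj jm.
have lt_i0 x : P x -> (d %| v i0 - v x - 1)%Z.
  by move=> Px; have [[ij _]|[_]//] := Pi0 _ Px; case: no; exists x.
left; split; first by have := mmin j Pj; lia.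
by apply: dvdz_eqr (rpredB (lt_i0 _ Pm) (lt_i0 _ Pj)) _; lia.
Qed.

(* Negating positions and values reverses [prec]. *)
Lemma prec_max (d : nat) v (P : int -> Prop) (L i0 j0 : int) : P j0 ->
  (forall x, P x -> x <= L) -> (forall j, P j -> prec d v j i0) ->
  exists2 m, P m & forall j, P j -> j <> m -> prec d v j m.
Proof.
move=> Pj0 PL Pi0; pose w x := - v (- x).
have precN x y : prec d w (- x) (- y) <-> prec d v y x.
  rewrite /prec /w !opprK; split=> -[[xy h]|[xy h]]; [left|right|left|right];
    (split; first lia); apply: dvdz_eqr h _; lia.
have [||x Px|m Pm mmin] := @prec_min d w (fun x => P (- x)) (- L) (- i0) (- j0).
- by rewrite opprK.
- by move=> x /PL; lia.
- by rewrite -[x]opprK; apply/precN/Pi0.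
exists (- m) => // j Pj jm; apply/precN; rewrite opprK; apply: mmin.
  by rewrite opprK.
by move=> E; apply: jm; rewrite -E opprK.
Qed.

(* [excess (runner e r) X Y] is the difference of the numbers of beads on runner [r]. *)
Definition runner (e : nat) r x : int := ((e%:Z %| x - r)%Z)%:Z.

(** * The exchange of two runners and sets with a common skeleton *)

Section SwapMap.
Variables (e : nat) (a : int).
Hypothesis e_gt1 : (1 < e)%N.

Local Notation on x := (e%:Z %| x - a)%Z.

(** The affine transposition of the residues [a] and [a + 1] modulo [e], acting on positions. *)
Definition sw x : int := if on x then x + 1 else if on (x - 1) then x - 1 else x.

Lemma sw_on x : on x -> sw x = x + 1.
Proof. by rewrite /sw => ->. Qed.

Lemma sw_on1 x : on (x - 1) -> sw x = x - 1.
Proof.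
move=> h; rewrite /sw h; case: ifP => // h'.
by have := on_pred e_gt1 h'; rewrite h.
Qed.

Lemma sw_off x : ~~ on x -> ~~ on (x - 1) -> sw x = x.
Proof. by rewrite /sw => /negPf -> /negPf ->. Qed.

Variant sw_spec x : int -> bool -> bool -> Prop :=
| SwOn of on x & ~~ on (x - 1) : sw_spec x (x + 1) true false
| SwOn1 of on (x - 1) & ~~ on x : sw_spec x (x - 1) false true
| SwOff of ~~ on x & ~~ on (x - 1) : sw_spec x x false false.

Lemma swP x : sw_spec x (sw x) (on x) (on (x - 1)).
Proof.
rewrite /sw; have [h|h] := boolP (on x).
  by rewrite (negPf (on_pred e_gt1 h)); constructor => //; apply: on_pred.
have [h'|h'] := boolP (on (x - 1)); by constructor.
Qed.

Lemma swK : involutive sw.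
Proof.
move=> x; case: (swP x) => h h'.
- by rewrite sw_on1 addrK.
- by rewrite sw_on // subrK.
- by rewrite sw_off.
Qed.

Lemma sw_congr x y : (e%:Z %| x - y)%Z -> (e%:Z %| sw x - sw y)%Z.
Proof.
move=> xy; have xy1 : (e%:Z %| (x - 1) - (y - 1))%Z by apply: dvdz_eqr xy _; lia.
by rewrite /sw (on_congr a xy) (on_congr a xy1);
  case: ifP => _; [|case: ifP => _]; apply: dvdz_eqr xy _; lia.
Qed.

Lemma runner_sw r x : runner e r (sw x) = runner e (sw r) x.
Proof.
rewrite /runner; congr (nat_of_bool _)%:Z.
by apply/idP/idP => /sw_congr; rewrite swK.
Qed.

Definition swp X : set int := [set x | X (sw x)].

Lemma ind_swp X x : ind (swp X) x = ind X (sw x).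
Proof. by case: (indP X (sw x)) => h; [rewrite ind1|rewrite ind0]. Qed.

Lemma swp_on X x : on x -> swp X x = X (x + 1) /\ swp X (x + 1) = X x.
Proof. by move=> ox; rewrite /swp /= sw_on// sw_on1 ?addrK. Qed.

Lemma swpK X : swp (swp X) = X.
Proof. by apply: eq_ind_set => x; rewrite !ind_swp swK. Qed.

Lemma maya_swp X : maya X -> maya (swp X).
Proof.
move=> [K XK]; exists K.+1 => x; rewrite /swp /=.
have : x - 1 <= sw x <= x + 1 by rewrite /sw; case: ifP => _; [|case: ifP => _]; lia.
by move=> h; split=> h'; apply XK; lia.
Qed.

Lemma excess_swp u X Y : excess u (swp X) (swp Y) = excess (fun x => u (sw x)) X Y.
Proof.
rewrite /excess (reindex_fsbigT _ _ (inv_bij swK)).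
by apply: eq_fsbigr => x _; rewrite !ind_swp swK.
Qed.

(** Off the two runners [sw] fixes [x], so this forces equality there; on them it fixes only the
    number of beads in each pair [x], [x + 1]. *)
Definition skel X Y := forall x, ind X x + ind X (sw x) = ind Y x + ind Y (sw x).

Lemma skel_sym X Y : skel X Y -> skel Y X.
Proof. by move=> h x; rewrite h. Qed.

Lemma skel_trans X Y Z : skel X Y -> skel Y Z -> skel X Z.
Proof. by move=> h h' x; rewrite h. Qed.

Lemma skel_swp X : skel X (swp X).
Proof. by move=> x; rewrite !ind_swp swK addrC. Qed.

Lemma skel_on X Y x : skel X Y -> on x ->
  ind X x + ind X (x + 1) = ind Y x + ind Y (x + 1).
Proof. by move=> /(_ x) + h; rewrite sw_on. Qed.

Lemma skel_off X Y x : skel X Y -> ~~ on x -> ~~ on (x - 1) -> ind X x = ind Y x.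
Proof. by move=> /(_ x) + h h'; rewrite sw_off//; lia. Qed.

(** The difference of the indicators of [X] and [Y] is odd under [sw]. *)
Lemma skel_excess u X Y : skel X Y -> maya X -> maya Y ->
  excess (fun x => u (sw x)) X Y = - excess u X Y.
Proof.
move=> XY mX mY; rewrite -excess_swp.
have := excessZ (-1) u mX mY; rewrite mulN1r => <-.
by apply: eq_fsbigr => x _; rewrite !ind_swp; have := XY x; nia.
Qed.

Lemma excess_sw X Y : maya X -> maya Y -> excess sw X Y =
  excess id X Y + excess (runner e a) X Y - excess (runner e (a + 1)) X Y.
Proof.
move=> mX mY.
have -> : excess sw X Y = excess (fun x => x + (runner e a x + -1 * runner e (a + 1) x)) X Y.
  apply: eq_excess => x _; rewrite /runner (_ : x - (a + 1) = x - 1 - a) /=; last lia.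
  by case: (swP x) => _ _ /=; lia.
by rewrite excessD// excessD// excessZ//; lia.
Qed.

Lemma skel_excess_runner1 X Y : skel X Y -> maya X -> maya Y ->
  excess (runner e (a + 1)) X Y = - excess (runner e a) X Y.
Proof.
move=> XY mX mY; rewrite -skel_excess//; apply: eq_excess => x _.
rewrite /runner (_ : x - (a + 1) = x - 1 - a); last lia.
case: (swP x) => h h'.
- by rewrite (negPf (on_succ e_gt1 h)).
- by rewrite h.
- by rewrite (negPf h).
Qed.

(** Inside a skeleton one number controls all the others. Runner [a + 1] has the opposite excess and
    the remaining runners agree. For the energy, oddness gives [excess sw = - excess id], whereas
    [sw] is the identity plus the indicator of runner [a] minus that of [a + 1]; so twice the energy
    vanishes. *)
Lemma skel_excess0 X Y : skel X Y -> maya X -> maya Y ->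
  excess (runner e a) X Y = 0 ->
  (forall r, excess (runner e r) X Y = 0) /\ excess id X Y = 0.
Proof.
move=> XY mX mY Da; have Da1 := skel_excess_runner1 XY mX mY; rewrite Da oppr0 in Da1.
split=> [r|].
- have runnerE s : on (r - s) -> excess (runner e r) X Y = excess (runner e (a + s)) X Y.
    move=> rs; apply: eq_excess => x _; rewrite /runner; congr (nat_of_bool _)%:Z.
    apply/idP/idP => h.
      by apply: dvdz_eqr (rpredD h rs) _; lia.
    by apply: dvdz_eqr (rpredB h rs) _; lia.
  have [h|h] := boolP (on r).
    by rewrite (runnerE 0) ?subr0// addr0.
  have [h'|h'] := boolP (on (r - 1)); first by rewrite (runnerE 1).
  apply: fsbig1 => x _; rewrite /runner.
  have [xr|] := boolP (e%:Z %| x - r)%Z; last by rewrite mul0r.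
  have ox : ~~ on x by rewrite (on_congr a xr).
  have ox1 : ~~ on (x - 1).
    by rewrite (@on_congr e a _ (r - 1))//; apply: dvdz_eqr xr _; lia.
  by rewrite (skel_off XY ox ox1) subrr mulr0.
- by have := skel_excess id XY mX mY; rewrite excess_sw// Da Da1; lia.
Qed.

Variable d : nat.
Hypothesis d_gt1 : (1 < d)%N.

(** Each pair [x], [x + 1] contains equally many gaps in both sets, so only the value in the middle
    of a pair, at a position on runner [a + 1], can differ. *)
Lemma gap_count_skel X Y f : skel X Y -> gap_count X f ->
  exists2 g, gap_count Y g & forall x, ~~ on (x - 1) -> g x = f x.
Proof.
move=> XY fX.
exists (fun x => if on (x - 1) then f (x - 1) + (1 - ind Y (x - 1)) else f x).
  move=> x /=; rewrite addrK; case: (swP x) => h h'.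
  - by [].
  - have := fX x; have := fX (x - 1); rewrite subrK.
    by have := skel_on XY h; rewrite subrK; lia.
  - by rewrite fX (skel_off XY).
by move=> x /negPf ->.
Qed.

Lemma calm_skel X Y f g : skel X Y -> (forall x, ~~ on (x - 1) -> g x = f x) ->
  calm e a d X f -> calm e a d Y g.
Proof.
move=> XY gf [C1 C2]; split.
  move=> b c Yb Yc cb ebc oc oc1.
  have ob : ~~ on b by rewrite (on_congr a ebc).
  have ob1 : ~~ on (b - 1).
    by rewrite (@on_congr e a _ (c - 1))//; apply: dvdz_eqr ebc _; lia.
  rewrite !gf//; apply: C1 => //.
    by have := skel_off XY ob ob1; rewrite (ind1 Yb); case: indP.
  by have := skel_off XY oc oc1; rewrite (ind0 Yc); case: indP.
move=> x y xy ox oy; have := C2 x y xy ox oy.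
by rewrite !(skel_on XY)// !gf// ?on_pred.
Qed.

Lemma well_ordered_eq X f g : (forall x, ~~ on (x - 1) -> g x = f x) ->
  well_ordered e a d X f <-> well_ordered e a d X g.
Proof.
move=> gf; split=> W i j oi oj Xi Xj; have := W i j oi oj Xi Xj;
  by rewrite /prec !gf ?on_pred.
Qed.

(** Within the skeleton of one balanced set [calm] is automatic, so balance is the ordering
    condition alone. It is stated for the fixed gap count of [X], which makes different [Y]
    comparable. *)
Lemma bal_skel X Y f : gap_count X f -> bal d e X -> skel X Y ->
  bal d e Y <-> well_ordered e a d Y f.
Proof.
move=> fX bX XY; have [cX _] := bal_calm a e_gt1 d_gt1 fX bX.
have [g gY gf] := gap_count_skel XY fX; split=> H.
  by have [_ /(well_ordered_eq _ gf)] := bal_calm a e_gt1 d_gt1 gY H.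
apply: calm_bal gY _ _ => //.
  exact: calm_skel XY gf cX.
exact/(well_ordered_eq _ gf).
Qed.
End SwapMap.

Implicit Types (m : int).

(** * Reflecting a balanced set *)

Section Reflection.
Variables (e : nat) (a : int).

Local Notation on x := (e%:Z %| x - a)%Z.
Local Notation skel := (skel e a).
Local Notation swp := (swp e a).
Local Notation charge := (excess (runner e a)).

Lemma charge_ge0 X Y : (forall x, on x -> ind Y x <= ind X x) -> 0 <= charge X Y.
Proof.
move=> YX; apply: excess_ge0 => x; rewrite /runner.
by have [/YX|] := boolP (on x); lia.
Qed.

Lemma charge_eq0 X Y : maya X -> maya Y -> (forall x, on x -> ind Y x <= ind X x) ->
  charge X Y = 0 -> forall x, on x -> ind X x = ind Y x.
Proof.
move=> mX mY YX D0 x ox.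
have h z : 0 <= runner e a z * (ind X z - ind Y z).
  by rewrite /runner; have [/YX|] := boolP (on z); lia.
have := excess_ge x mX mY h; rewrite D0 /runner ox.
by have := YX x ox; lia.
Qed.

Lemma charge_neq X Y : maya X -> maya Y -> charge X Y = 0 ->
  (exists2 x, on x & ind X x <> ind Y x) ->
  exists i, exists j, [/\ on i, on j, X i /\ ~ Y i & Y j /\ ~ X j].
Proof.
move=> mX mY D0 [x ox xXY].
have gt Z W : maya Z -> maya W -> charge Z W = 0 -> ind Z x <> ind W x ->
    exists2 i, on i & Z i /\ ~ W i.
  move=> mZ mW ZW0 ne; apply: contrapT => no; apply: ne; apply/esym.
  apply: charge_eq0 ox => //; last by rewrite excessC// ZW0 oppr0.
  move=> z oz; case: (indP Z z) => Zz; case: (indP W z) => Wz //.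
  by case: no; exists z.
have [i oi XYi] := gt _ _ mX mY D0 xXY.
have [|j oj YXj] := gt _ _ mY mX _ (fun h => xXY (esym h)).
  by rewrite excessC// D0 oppr0.
by exists i, j.
Qed.

Hypothesis e_gt1 : (1 < e)%N.

Lemma skel_addable X Y x : skel X Y -> on x -> X x -> ~ Y x -> addable X x /\ removable Y x.
Proof.
move=> XY ox Xx Yx; have := skel_on XY ox; rewrite (ind1 Xx) (ind0 Yx) /addable /removable.
by case: (indP X (x + 1)) => ?; case: (indP Y (x + 1)) => ? E; try lia; split; split.
Qed.

Variable d : nat.
Hypothesis d_gt1 : (1 < d)%N.

(** If they differed, equal charge would give [i] in [X] only and [j] in [Y] only on runner [a].
    Then [i] is addable and [j] removable in [X], and conversely in [Y], so [prec] would hold both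
    ways for the same gap count. *)
Lemma bal_skel_inj X Y : maya X -> maya Y -> bal d e X -> bal d e Y -> skel X Y ->
  charge X Y = 0 -> X = Y.
Proof.
move=> mX mY bX bY XY D0; have [f fX] := gap_count_ex X.
have XX : skel X X by [].
have wX := (bal_skel e_gt1 d_gt1 fX bX XX).1 bX.
have wY := (bal_skel e_gt1 d_gt1 fX bX XY).1 bY.
have on_eq x : on x -> ind X x = ind Y x.
  move=> ox; apply: contrapT => ne.
  have [i [j [oi oj [Xi Yi] [Yj Xj]]]] := charge_neq mX mY D0 (ex_intro2 _ _ x ox ne).
  have [uXi dYi] := skel_addable XY oi Xi Yi.
  have [uYj dXj] := skel_addable (skel_sym XY) oj Yj Xj.
  exact: (prec_asym d_gt1 (wX _ _ oi oj uXi dXj) (wY _ _ oj oi uYj dYi)).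
apply: eq_ind_set => x; have [ox|ox] := boolP (on x); first exact: on_eq.
have [ox1|ox1] := boolP (on (x - 1)); last exact: (skel_off e_gt1 XY ox ox1).
by have := skel_on XY ox1; rewrite subrK (on_eq _ ox1) => /addrI.
Qed.

Definition flip X m : set int :=
  [set x | if x == m then X (m + 1) else if x == m + 1 then X m else X x].

Lemma ind_flip X m x : ind (flip X m) x =
  if x == m then ind X (m + 1) else if x == m + 1 then ind X m else ind X x.
Proof.
by case: ifP => h; [|case: ifP => h']; apply: ind_iff; rewrite /flip /= h ?h'.
Qed.

Lemma skel_flip X m : on m -> skel X (flip X m).
Proof.
move=> om x; rewrite !ind_flip; case: (swP a e_gt1 x) => h h'.
- have -> : x == m + 1 = false.
    by apply/eqP => E; have := on_succ e_gt1 om; rewrite -E h.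
  have -> : x + 1 == m = false.
    by apply/eqP => E; have := on_succ e_gt1 h; rewrite E om.
  by rewrite (inj_eq (addIr 1)); case: eqP => [->|//]; rewrite addrC.
- have -> : x == m = false by apply/eqP => E; rewrite E om in h'.
  have -> : x - 1 == m + 1 = false.
    by apply/eqP => E; have := on_succ e_gt1 om; rewrite -E h.
  by rewrite subr_eq; case: eqP => [->|//]; rewrite addrK addrC.
- have -> : x == m = false by apply/eqP => E; rewrite E om in h.
  have -> // : x == m + 1 = false.
  by apply/eqP => E; rewrite E addrK om in h'.
Qed.

Lemma maya_flip X m : maya X -> maya (flip X m).
Proof.
move=> [K XK]; exists (K + (absz m).+2)%N => x; rewrite /flip /=.
by split=> h; rewrite !ifF; try (by lia); apply XK; lia.
Qed.

Lemma charge_flip X m : on m -> charge (flip X m) X = ind X (m + 1) - ind X m.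
Proof.
move=> om; rewrite (@excess_seq [:: m; m + 1]).
- rewrite !big_cons big_nil !ind_flip eqxx eqxx ifF; last by lia.
  by rewrite /runner om (negPf (on_succ e_gt1 om)); lia.
- by rewrite /= inE; lia.
- by move=> x; rewrite !inE negb_or ind_flip => /andP[/negPf -> /negPf ->].
Qed.

Lemma flip_eq X m : flip X m m = X (m + 1) /\ flip X m (m + 1) = X m.
Proof. by rewrite /flip /= !eqxx ifF//; lia. Qed.

Lemma flip_neq X m j : on m -> on j -> j <> m ->
  flip X m j = X j /\ flip X m (j + 1) = X (j + 1).
Proof.
move=> om oj /eqP/negPf jm.
have E1 : j == m + 1 = false.
  by apply/eqP => E; have := on_succ e_gt1 om; rewrite -E oj.
have E2 : j + 1 == m = false.
  by apply/eqP => E; have := on_succ e_gt1 oj; rewrite E om.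
by rewrite /flip /= (inj_eq (addIr 1)) jm E1 E2.
Qed.

(** The flip makes [m] addable, and by its minimality it precedes every removable position that
    remains. *)
Lemma flip_removable v X m : on m -> removable X m -> well_ordered e a d X v ->
  (forall j, on j /\ removable X j -> j <> m -> prec d v m j) ->
  well_ordered e a d (flip X m) v.
Proof.
move=> om [nXm Xm1] wX mprec i j oi oj; rewrite /addable /removable.
have [-> {i oi}|/eqP im] := eqVneq i m; have [-> {j oj}|/eqP jm] := eqVneq j m;
  rewrite ?(flip_eq X m).1 ?(flip_eq X m).2.
- by move=> _ [].
- by have [-> ->] := flip_neq X om oj jm => _ rj; apply: mprec.
- by move=> _ [].
- have [-> ->] := flip_neq X om oi im; have [-> ->] := flip_neq X om oj jm.
  exact: wX.
Qed.

Lemma flip_addable v X m : on m -> addable X m -> well_ordered e a d X v ->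
  (forall i, on i /\ addable X i -> i <> m -> prec d v i m) ->
  well_ordered e a d (flip X m) v.
Proof.
move=> om [Xm nXm1] wX mprec i j oi oj; rewrite /addable /removable.
have [-> {i oi}|/eqP im] := eqVneq i m; have [-> {j oj}|/eqP jm] := eqVneq j m;
  rewrite ?(flip_eq X m).1 ?(flip_eq X m).2.
- by move=> [].
- by move=> [].
- by have [-> ->] := flip_neq X om oi im => ai _; apply: mprec.
- have [-> ->] := flip_neq X om oi im; have [-> ->] := flip_neq X om oj jm.
  exact: wX.
Qed.

Lemma skel_swp_removable X Y : skel X Y -> (forall j, on j -> ~ removable Y j) ->
  forall x, on x -> ind (swp X) x <= ind Y x.
Proof.
move=> XY noR x ox; rewrite ind_swp sw_on//; have := skel_on XY ox.
have := noR x ox; rewrite /removable.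
case: (indP X x) => h1; case: (indP X (x + 1)) => h2; case: (indP Y x) => h3;
  case: (indP Y (x + 1)) => h4 //; tauto.
Qed.

Lemma skel_swp_addable X Y : skel X Y -> (forall j, on j -> ~ addable Y j) ->
  forall x, on x -> ind Y x <= ind (swp X) x.
Proof.
move=> XY noR x ox; rewrite ind_swp sw_on//; have := skel_on XY ox.
have := noR x ox; rewrite /addable.
case: (indP X x) => h1; case: (indP X (x + 1)) => h2; case: (indP Y x) => h3;
  case: (indP Y (x + 1)) => h4 //; tauto.
Qed.

(** Induction on the missing charge: flipping the [prec]-first removable position keeps balance and
    raises the charge by one. The addable position serves as base point for [prec_min] and survives
    every flip. *)
Lemma raise_charge (n : nat) X Y : maya X -> maya Y -> bal d e Y -> skel X Y ->
  (exists2 i, on i & addable Y i) -> charge Y (swp X) = - n%:Z ->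
  exists Z, [/\ maya Z, bal d e Z, skel X Z & charge Z (swp X) = 0].
Proof.
move=> mX; elim: n Y => [|n IH] Y mY bY XY [i0 oi0 ai0] D.
  by exists Y; rewrite D oppr0.
have [f fY] := gap_count_ex Y.
have YY : skel Y Y by [].
have wY := (bal_skel e_gt1 d_gt1 fY bY YY).1 bY.
(* Without removable positions [Y] contains [swp X] on runner [a], and its charge could not be
   negative. *)
have [[j0 oj0 rj0]|no] := pselect (exists2 j, on j & removable Y j); last first.
  have := charge_ge0 (skel_swp_removable XY _); rewrite D => h.
  suff : 0 <= - n.+1%:Z by lia.
  by apply: h => j oj rj; apply: no; exists j.
have [K YK] := mY.
have [|||m [om rm] mmin] := @prec_min d f (fun j => on j /\ removable Y j) (- K%:Z - 1) i0 j0.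
- by [].
- by move=> x [_ [Yx _]]; have [h _] := YK x; apply: contrapT => lt; apply: Yx; apply: h; lia.
- by move=> j [oj rj]; apply: wY.
have im : i0 <> m by move=> E; case: ai0; case: rm; rewrite E.
apply: (IH (flip Y m)).
- exact: maya_flip.
- by apply/(bal_skel e_gt1 d_gt1 fY bY (skel_flip _ om)); apply: flip_removable.
- exact: skel_trans XY (skel_flip _ om).
- exists i0 => //; rewrite /addable.
  by have [-> ->] := flip_neq Y om oi0 im.
- rewrite -(excess_trans _ (maya_flip m mY) mY (maya_swp a e_gt1 mX)) D charge_flip//.
  by case: rm => r1 r2; rewrite (ind0 r1) (ind1 r2); lia.
Qed.

(** Mirror image of [raise_charge]: flipping the [prec]-last addable position lowers the charge by
    one. *)
Lemma lower_charge (n : nat) X Y : maya X -> maya Y -> bal d e Y -> skel X Y ->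
  (exists2 i, on i & removable Y i) -> charge Y (swp X) = n%:Z ->
  exists Z, [/\ maya Z, bal d e Z, skel X Z & charge Z (swp X) = 0].
Proof.
move=> mX; elim: n Y => [|n IH] Y mY bY XY [i0 oi0 ri0] D.
  by exists Y; rewrite D.
have [f fY] := gap_count_ex Y.
have YY : skel Y Y by [].
have wY := (bal_skel e_gt1 d_gt1 fY bY YY).1 bY.
have [[j0 oj0 aj0]|no] := pselect (exists2 j, on j & addable Y j); last first.
  have := charge_ge0 (skel_swp_addable XY _).
  rewrite (excessC _ mY (maya_swp a e_gt1 mX)) D => h.
  suff : 0 <= - n.+1%:Z by lia.
  by apply: h => j oj aj; apply: no; exists j.
have [K YK] := mY.
have [|||m [om am] mmin] := @prec_max d f (fun j => on j /\ addable Y j) K i0 j0.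
- by [].
- by move=> x [_ [Yx _]]; have [_ h] := YK x; apply: contrapT => lt; apply: h Yx; lia.
- by move=> j [oj aj]; apply: wY.
have im : i0 <> m by move=> E; case: am; case: ri0; rewrite E.
apply: (IH (flip Y m)).
- exact: maya_flip.
- by apply/(bal_skel e_gt1 d_gt1 fY bY (skel_flip _ om)); apply: flip_addable.
- exact: skel_trans XY (skel_flip _ om).
- exists i0 => //; rewrite /removable.
  by have [-> ->] := flip_neq Y om oi0 im.
- rewrite -(excess_trans _ (maya_flip m mY) mY (maya_swp a e_gt1 mX)) D charge_flip//.
  by case: am => r1 r2; rewrite (ind1 r1) (ind0 r2); lia.
Qed.

(** If [X] has no addable or no removable position on runner [a], then [swp X] is well ordered
    vacuously and can be taken. Otherwise one starts from [X] itself, which has the right skeleton,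
    and corrects its charge step by step. *)
Lemma bal_reflection X : maya X -> bal d e X ->
  exists Y, [/\ maya Y, bal d e Y, skel X Y & charge Y (swp X) = 0].
Proof.
move=> mX bX; have XX : skel X X by [].
have [f fX] := gap_count_ex X.
have mS := maya_swp a e_gt1 mX.
have swp_case : (forall i, on i -> ~ addable X i) \/ (forall i, on i -> ~ removable X i) ->
    exists Y, [/\ maya Y, bal d e Y, skel X Y & charge Y (swp X) = 0].
  move=> no; exists (swp X); split=> //; [|exact: skel_swp|exact: excessxx].
  apply: (bal_skel e_gt1 d_gt1 fX bX (skel_swp a e_gt1 X)).2 => i j oi oj.
  rewrite /addable /removable.
  have [-> ->] := swp_on e_gt1 X oi; have [-> ->] := swp_on e_gt1 X oj => -[h1 h2] [h3 h4].
  by case: no => no; [case: (no j oj)|case: (no i oi)].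
have [[i oi ai]|noA] := pselect (exists2 i, on i & addable X i); last first.
  by apply: swp_case; left=> i oi ai; apply: noA; exists i.
have [[j oj rj]|noR] := pselect (exists2 j, on j & removable X j); last first.
  by apply: swp_case; right=> j oj rj; apply: noR; exists j.
have [le0|ge0] := lerP (charge X (swp X)) 0.
  apply: (@raise_charge (absz (charge X (swp X))) X X) => //; first by exists i.
  by lia.
apply: (@lower_charge (absz (charge X (swp X))) X X) => //; first by exists j.
by lia.
Qed.
End Reflection.

(** * Independence of the core *)

(** The balanced part of a block in terms of beta-sets: for a core [G], having core [G] amounts to
    having as many beads as [G] on every runner, and the weight is the energy above [G] divided by
    [e]. *)
Definition bal_block (d e : nat) G (w : nat) : set (set int) :=
  [set X | [/\ maya X, bal d e X, forall r, excess (runner e r) X G = 0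
             & excess id X G = w%:Z * e%:Z]].

(** Reflections are picked by choice; uniqueness within a skeleton makes the resulting map
    injective. As [swp] is an involution, this inequality applied twice gives equality. *)
Lemma bal_block_le (d e w : nat) (a : int) G : (1 < d)%N -> (1 < e)%N -> maya G ->
  bal_block d e G w #<= bal_block d e (swp e a G) w.
Proof.
move=> d_gt1 e_gt1 mG; have mSG := maya_swp a e_gt1 mG.
have ex X : exists Y, bal_block d e G w X -> [/\ maya Y, bal d e Y, skel e a X Y
    & excess (runner e a) Y (swp e a X) = 0].
  have [[mX bX _ _]|no] := pselect (bal_block d e G w X); last by exists X.
  by have [Y YP] := bal_reflection a e_gt1 d_gt1 mX bX; exists Y.
have [F FP] := choice ex.
have Finj : {in bal_block d e G w &, injective F}.
  move=> X X' /set_mem bX /set_mem bX' FXX'.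
  have [mY bY sXY cXY] := FP _ bX; have [_ _ sXY' cXY'] := FP _ bX'.
  rewrite -FXX' in sXY' cXY'.
  have [mX balX _ _] := bX; have [mX' balX' _ _] := bX'.
  have sXX' : skel e a X X' := skel_trans sXY (skel_sym sXY').
  apply: (bal_skel_inj e_gt1 d_gt1 mX mX' balX balX' sXX').
  have mSX := maya_swp a e_gt1 mX; have mSX' := maya_swp a e_gt1 mX'.
  (* The charge of [X] against [X'] is opposite to that of [swp X] against [swp X'], and both of the
     latter have the charge of the common image. *)
  have := skel_excess e_gt1 (runner e a) sXX' mX mX'.
  rewrite -excess_swp// -(excess_trans _ mSX mY mSX') cXY' (excessC _ mY mSX) cXY.
  by lia.
have /card_eqPle[_ le] := inj_card_eq Finj.
apply: card_le_trans le _; apply: subset_card_le => _ [X bX <-].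
have [mY bY sXY cXY] := FP _ bX; have [mX balX rX wX] := bX.
have mSX := maya_swp a e_gt1 mX.
have sYS : skel e a (F X) (swp e a X) := skel_trans (skel_sym sXY) (skel_swp a e_gt1 X).
(* Equal charge within one skeleton lets [swp X] stand in for [F X]; exchanging [X] and [G]
   simultaneously only permutes the runners. *)
have [r0 id0] := skel_excess0 e_gt1 sYS mY mSX cXY.
split=> // [r|].
  rewrite -(excess_trans _ mY mSX mSG) r0 excess_swp// add0r -(rX (sw e a r)).
  by apply: eq_excess => x _; rewrite runner_sw.
by rewrite -(excess_trans _ mY mSX mSG) id0 excess_swp// add0r excess_sw// !rX wX; lia.
Qed.

Lemma bal_block_swp (d e w : nat) (a : int) G : (1 < d)%N -> (1 < e)%N -> maya G ->
  bal_block d e G w #= bal_block d e (swp e a G) w.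
Proof.
move=> d1 e1 mG; apply/card_eqPle; split; first exact: bal_block_le.
by rewrite -{2}(swpK a e1 G); apply: bal_block_le => //; apply: maya_swp.
Qed.

(** * Descent to the empty core *)

Definition vacuum : set int := [set x | x < 0].

Lemma maya_lt c : maya [set x | x < c].
Proof. by exists (absz c) => x /=; split; lia. Qed.

Definition ecore_set (e : nat) G := forall x, G x -> G (x - e%:Z).

Lemma ecore_set_le (e : nat) G x y : ecore_set e G -> G x -> y <= x ->
  (e%:Z %| x - y)%Z -> G y.
Proof.
move=> eG Gx yx /dvdzP[q Eq].
have h (n : nat) : G (x - n%:Z * e%:Z).
  elim: n => [|n IH]; first by rewrite mul0r subr0.
  by have := eG _ IH; congr (G _); lia.
have [E|en0] := eqVneq e 0%N; first by move: Eq; rewrite E mulr0 => /subr0_eq <-.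
have := h (absz q); congr (G _).
have : 0 <= q by nia.
by nia.
Qed.

(** Runners of a core have no holes. With a gap at [x] and a bead at [x + 1], every bead on the
    runner of [x] therefore has a bead to its right, so the exchange moves at least one bead one
    step left and none to the right. *)
Lemma swp_descent (e : nat) G x : (1 < e)%N -> maya G -> ecore_set e G ->
  removable G x -> excess id (swp e x G) G < 0 /\ excess (fun=> 1) (swp e x G) G = 0.
Proof.
move=> e1 mG cG [nGx Gx1]; have mS := maya_swp x e1 mG.
have sS : skel e x (swp e x G) G := skel_sym (skel_swp x e1 G).
have xx : (e%:Z %| x - x)%Z by rewrite subrr dvdz0.
split; last by have := skel_excess e1 (fun=> 1) sS mS mG; lia.
have := skel_excess e1 id sS mS mG; rewrite excess_sw// (skel_excess_runner1 e1 sS mS mG).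
have ge y : 0 <= runner e x y * (ind (swp e x G) y - ind G y).
  rewrite /runner; have [oy|] := boolP (e%:Z %| y - x)%Z; last by lia.
  rewrite ind_swp sw_on//.
  case: (indP G y) => // Gy.
  rewrite ind1 //; have [xy|yx] := lerP x y.
    by case: nGx; apply: (ecore_set_le cG Gy xy).
  apply: (ecore_set_le cG Gx1); first lia.
  by move: oy; rewrite -rpredN => oy; apply: dvdz_eqr oy _; lia.
have := excess_ge x mS mG ge.
rewrite /runner xx ind_swp sw_on// (ind0 nGx) (ind1 Gx1).
by lia.
Qed.

Lemma ecore_set_swp (e : nat) (a : int) G : (1 < e)%N -> ecore_set e G ->
  ecore_set e (swp e a G).
Proof.
move=> e1 cG x; rewrite /swp /=.
have -> : sw e a (x - e%:Z) = sw e a x - e%:Z.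
  have ex : (e%:Z %| x - (x - e%:Z))%Z by rewrite subKr dvdzz.
  have ex1 : (e%:Z %| (x - 1) - (x - e%:Z - 1))%Z by apply: dvdz_eqr ex _; lia.
  by rewrite /sw (on_congr a ex) (on_congr a ex1); case: ifP => _; [|case: ifP => _]; lia.
exact: cG.
Qed.

Lemma energy_ge0 G : 0 <= excess id G vacuum.
Proof.
apply: excess_ge0 => x; rewrite /vacuum.
case: (indP G x) => _; case: (indP _ x) => /= h; lia.
Qed.

Lemma lt_vacuum c : excess (fun=> 1) [set x | x < c] vacuum = 0 -> c = 0.
Proof.
move=> D0; have [mc mv] := (maya_lt c, maya_lt 0 : maya vacuum).
have D0' : excess (fun=> 1) vacuum [set x | x < c] = 0 by rewrite excessC// D0 oppr0.
have [c0|c0|//] := ltgtP c 0.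
- have := @excess_ge (fun=> 1) _ _ c mv mc; rewrite D0' /vacuum (ind1 c0) ind0 /=; last by lia.
  suff : forall x, 0 <= 1 * (ind [set x | x < 0] x - ind [set x | x < c] x).
    by move=> h /(_ h).
  by move=> x; case: indP => /= h1; case: indP => /= h2; lia.
- have := @excess_ge (fun=> 1) _ _ 0 mc mv; rewrite D0 /vacuum (ind1 c0) ind0 /=; last by lia.
  suff : forall x, 0 <= 1 * (ind [set x | x < c] x - ind [set x | x < 0] x).
    by move=> h /(_ h).
  by move=> x; case: indP => /= h1; case: indP => /= h2; lia.
Qed.

(** Induction on the energy of the core. A removable position gives a reflection of smaller energy;
    without one the core is a half-line, and charge zero makes it the beta-set of the empty
    partition. *)
Lemma bal_block_vacuum (d e w : nat) G : (1 < d)%N -> (1 < e)%N -> maya G ->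
  ecore_set e G -> excess (fun=> 1) G vacuum = 0 ->
  bal_block d e G w #= bal_block d e vacuum w.
Proof.
move=> d1 e1; have [n] := ubnP (absz (excess id G vacuum)).
have mv : maya vacuum := maya_lt 0.
elim: n G => // n IH G En mG cG G0.
have [[x Gx]|no] := pselect (exists x, removable G x); last first.
  have [K GK] := mG.
  have [||c nGc cmin] := @int_has_min (fun x => ~ G x) (- K%:Z) K%:Z.
  - by have [_] := GK K%:Z; apply.
  - by move=> x nGx; have [h _] := GK x; apply: contrapT => lt; apply/nGx/h; lia.
  have down (k : nat) x : G (x + k%:Z) -> G x.
    elim: k x => [|k IHk] x; first by rewrite addr0.
    move=> h; apply: IHk; apply: contrapT => h'; apply: no; exists (x + k%:Z).
    by split=> //; have := h; congr (G _); lia.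
  have E : G = [set x | x < c].
    apply/seteqP; split=> x /= h.
      have [//|cx] := ltrP x c; case: nGc; apply: (down (absz (x - c))).
      by have := h; congr (G _); lia.
    by apply: contrapT => /cmin; lia.
  by move: G0; rewrite E => /lt_vacuum ->.
have mS := maya_swp x e1 mG; have [lt0 c0] := swp_descent e1 mG cG Gx.
apply: card_eq_trans (bal_block_swp w x d1 e1 mG) _; apply: IH => //.
- have := excess_trans id mS mG mv; have := energy_ge0 (swp e x G); lia.
- exact: ecore_set_swp.
- by rewrite -(excess_trans _ mS mG mv) c0 add0r.
Qed.

(** * Beta-sets of partitions *)

(** Indexed from 0, these are the elements of the beta-set in decreasing order. *)
Definition bead la (i : nat) : int := (nth 0%N la i)%:Z - i.+1%:Z.

Lemma beta_setE la : beta_set la = [set b | exists i, b = bead la i].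
Proof.
apply/seteqP; split=> b /= [].
  by case=> // i _ ->; exists i.
by move=> i ->; exists i.+1.
Qed.

Lemma beta_set_bead la i : beta_set la (bead la i).
Proof. by rewrite beta_setE; exists i. Qed.

Lemma intpart_sorted la : sorted geq la.
Proof. by case: la => s /= /andP[]. Qed.

Lemma intpart_gt0 la i : (0 < nth 0 la i)%N = (i < size la)%N.
Proof.
case: la => s /= /andP[_ s0]; have [si|si] := ltnP i (size s).
  exact: (allP s0 _ (mem_nth _ si)).
by rewrite nth_default.
Qed.

Lemma ltn_count_sorted (s : seq nat) (c i : nat) : sorted geq s -> (0 < c)%N ->
  (i < count (leq c) s)%N = (c <= nth 0 s i)%N.
Proof.
move=> + c0; elim: s i => [|x s IH] i; first by rewrite nth_nil /=; lia.
rewrite /= (path_sortedE (rev_trans leq_trans)) => /andP[/allP sx ss].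
have [cx|cx] := leqP c x; first by case: i => [|i] /=; [lia|rewrite -IH].
have -> : count (leq c) s = 0%N.
  by apply/eqP; rewrite -leqn0 leqNgt -has_count -all_predC; apply/allP => y /sx /=; lia.
case: i => [|i] /=; first lia.
have [si|si] := ltnP i (size s); first by have := sx _ (mem_nth 0%N si) => /=; lia.
by rewrite nth_default//; lia.
Qed.

Lemma ltn_conj_part la (c i : nat) : (0 < c)%N -> (i < conj_part la c)%N = (c <= nth 0 la i)%N.
Proof. exact/ltn_count_sorted/intpart_sorted. Qed.

Lemma nth_intpart_leq la i j : (i <= j)%N -> (nth 0 la j <= nth 0 la i)%N.
Proof.
move=> ij; case E : (nth 0%N la j) => [//|c].
rewrite -ltn_conj_part//; apply: leq_ltn_trans ij _.
by rewrite ltn_conj_part// E.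
Qed.

Lemma bead_lt la i j : (i < j)%N -> bead la j < bead la i.
Proof. by move=> ij; rewrite /bead; have := nth_intpart_leq la (ltnW ij); lia. Qed.

Lemma bead_inj la : injective (bead la).
Proof.
move=> i j E; have [/(bead_lt la)|/(bead_lt la)|//] := ltngtP i j; by rewrite E ltxx.
Qed.

Lemma bead_large la i : (size la <= i)%N -> bead la i = - i.+1%:Z.
Proof. by move=> h; rewrite /bead nth_default// sub0r. Qed.

Lemma maya_beta_set la : maya (beta_set la).
Proof.
exists (size la + nth 0 la 0)%N => x; rewrite beta_setE /=; split=> h.
  by exists (absz (x + 1)); rewrite bead_large; lia.
by case=> i E; have := nth_intpart_leq la (leq0n i); move: E; rewrite /bead; lia.
Qed.

Lemma sum_eq_inj (p : nat -> int) (n : nat) x : injective p ->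
  \sum_(i < n) (x == p i)%:Z = ind [set y | exists2 i, (i < n)%N & y = p i] x.
Proof.
move=> pI; case: (indP _ x) => /= [[i i_n ->]|no].
  rewrite (bigD1 (Ordinal i_n))//= eqxx big1 ?addr0// => j.
  by rewrite -val_eqE /= => /negPf ji; rewrite (inj_eq pI) eq_sym ji.
rewrite big1// => i _; case: eqP => // E; by exfalso; apply: no; exists (nat_of_ord i).
Qed.

(** Bead [i] is moved from its place [- i.+1] in the empty partition to [bead la i]; from index
    [size la] on the two coincide. *)
Lemma excess_beta_set u la : excess u (beta_set la) vacuum =
  \sum_(i < size la) (u (bead la i) - u (- i.+1%:Z)).
Proof.
apply: (@excess_delta _ (bead la) (fun i => - i.+1%:Z)) => x.
rewrite sumrB !sum_eq_inj; [|by move=> i j /=; lia|exact: bead_inj].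
have small i : (i < size la)%N -> - (size la)%:Z <= bead la i.
  by rewrite /bead; lia.
rewrite /vacuum beta_setE; have [xl|xl] := ltrP x (- (size la)%:Z).
  rewrite ind1; last by exists (absz (x + 1)); rewrite bead_large; lia.
  rewrite ind1 /=; last by lia.
  rewrite !ind0 //= => -[i il E]; by have := small _ il; lia.
congr (_ - _); apply: ind_iff => /=; split.
- move=> [i E]; exists i => //.
  by rewrite ltnNge; apply/negP => le; move: E; rewrite bead_large//; lia.
- by move=> [i _ E]; exists i.
- by move=> x0; exists (absz (x + 1)); rewrite ?NegzE; lia.
- by move=> [i _]; rewrite NegzE; lia.
Qed.

Lemma psize_excess la : excess id (beta_set la) vacuum = (psize la)%:Z.
Proof.
rewrite excess_beta_set /psize sumnE (big_nth 0%N) big_mkord.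
rewrite (big_morph Posz PoszD (erefl : Posz 0 = 0)); apply: eq_bigr => i _.
by rewrite /bead /=; lia.
Qed.

Lemma excess_beta_set_vacuum la : excess (fun=> 1) (beta_set la) vacuum = 0.
Proof. by rewrite excess_beta_set big1// => i _; rewrite subrr. Qed.

(** By strong induction the beads of index [i] agree: each occurs in the other set, where the larger
    beads are already matched. *)
Lemma beta_set_inj : injective beta_set.
Proof.
move=> la mu E.
have le nu nu' i : beta_set nu = beta_set nu' ->
    (forall j, (j < i)%N -> bead nu j = bead nu' j) -> bead nu i <= bead nu' i.
  move=> Enu IH; have := beta_set_bead nu i; rewrite Enu beta_setE => -[k Ek].
  have [ki|ik|ki] := ltngtP k i; last by rewrite Ek ki.
    by have := IH k ki; rewrite -Ek => /bead_inj; lia.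
  by rewrite Ek ltW// bead_lt.
have Eb i : bead la i = bead mu i.
  have [n] := ubnP i; elim: n i => // n IH i i_n.
  have IHi j : (j < i)%N -> bead la j = bead mu j by move=> ji; apply: IH; lia.
  by apply: le_anti; rewrite !le// => j /IHi.
have En i : nth 0%N la i = nth 0%N mu i by have := Eb i; rewrite /bead; lia.
apply: val_inj; apply: (@eq_from_nth _ 0%N) => // /=.
have sz i : (i < size la)%N = (i < size mu)%N by rewrite -!intpart_gt0 En.
have := sz (size la); have := sz (size mu); rewrite !ltnn; lia.
Qed.

Lemma nth_filter_gt0 (s : seq nat) (i : nat) : sorted geq s ->
  nth 0%N (filter (leq 1) s) i = nth 0%N s i.
Proof.
elim: s i => [//|x s IH] i; rewrite /= (path_sortedE (rev_trans leq_trans)).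
move=> /andP[/allP sx ss]; have [x0|x0] := leqP 1 x.
  by case: i => [|i] //=; rewrite IH.
have s0 (y : nat) : y \in x :: s -> y = 0%N.
  by rewrite inE => /orP[/eqP ->|/sx /=]; lia.
have -> : filter (leq 1) s = [::].
  apply/eqP; rewrite -[_ == _]negbK -has_filter -all_predC; apply/allP => y ys /=.
  by rewrite (s0 y)// inE ys orbT.
rewrite nth_nil; have [h|h] := ltnP i (size (x :: s)); last by rewrite nth_default.
by rewrite (s0 _ (mem_nth 0%N h)).
Qed.

Lemma beta_set_surj X : maya X -> excess (fun=> 1) X vacuum = 0 ->
  exists la, beta_set la = X.
Proof.
move=> [K0 XK0] X0.
have [K [XK K_gt0]] : exists K, bounded_by K X /\ (0 < K)%N.
  by exists K0.+1; split=> //; apply: bounded_by_leq XK0.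
have vK : bounded_by K vacuum by move=> x; rewrite /vacuum /=; lia.
pose s := [seq x <- rev (window K) | x \in X].
have mem_s x : (x \in s) = (- K%:Z <= x < K%:Z) && (x \in X).
  by rewrite mem_filter mem_rev mem_window andbC.
(* Charge zero: the window holds as many beads of [X] as of [vacuum], namely [K]. *)
have sz : size s = K.
  move: X0; rewrite (excess_window _ XK vK).
  under eq_bigr do rewrite mul1r.
  rewrite sumrB.
  have cnt Y (t : seq int) : \sum_(x <- t) ind Y x = (count (fun x => x \in Y) t)%:Z.
    elim: t => [|x t IH]; first by rewrite big_nil.
    by rewrite big_cons IH /= PoszD.
  rewrite !cnt -(count_rev (fun x => x \in X)) -size_filter -/s.
  have -> : count (fun x => x \in vacuum) (window K) = K.
    rewrite count_map -addnn iotaD count_cat.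
    rewrite [X in (X + _)%N](_ : _ = K); last first.
      rewrite -[RHS](size_iota 0 K); apply/eqP; rewrite -all_count; apply/allP => i.
      by rewrite mem_iota /= => iK; apply/mem_set; rewrite /vacuum /=; lia.
    rewrite [X in (_ + X)%N](_ : _ = 0%N) ?addn0//; apply/eqP; rewrite -leqn0 leqNgt -has_count.
    by apply/negP => /hasP[i]; rewrite mem_iota /= => iK /set_mem; rewrite /vacuum /=; lia.
  by lia.
have ss : sorted (fun x y : int => y < x) s.
  apply: sorted_filter; first by move=> x y z h1 h2; apply: lt_trans h2 h1.
  rewrite rev_sorted /window sorted_map.
  apply: sub_sorted (iota_ltn_sorted 0 K.*2) => i j /=; lia.
have s_lt i j : (i < j)%N -> (j < K)%N -> nth 0 s j < nth 0 s i.
  move=> ij jK; apply: (sorted_ltn_nth _ 0 ss) => //; rewrite ?inE ?sz//.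
  - by move=> x y z h1 h2; apply: lt_trans h2 h1.
  - exact: ltn_trans jK.
have s_mem i : (i < K)%N -> nth 0 s i \in s by move=> iK; rewrite mem_nth ?sz.
(* The list decreases strictly and its last entry, at index [K - 1], is at least [- K]; so the parts
   defined next are not truncated by [absz]. *)
have s_ge i : (i < K)%N -> - i.+1%:Z <= nth 0 s i.
  move=> iK; have h (k : nat) : (i + k < K)%N -> nth 0 s (i + k) + k%:Z <= nth 0 s i.
    elim: k => [|k IH] ik; first by rewrite addn0 addr0.
    have /IH : (i + k < K)%N by lia.
    by have := @s_lt (i + k)%N (i + k.+1)%N; lia.
  have iK1 : (i + (K.-1 - i) < K)%N by lia.
  by have := h _ iK1; have := s_mem _ iK1; rewrite mem_s; lia.
pose t := mkseq (fun i => absz (nth 0 s i + i.+1%:Z)) K.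
have nth_t i : (i < K)%N -> (nth 0%N t i)%:Z = nth 0 s i + i.+1%:Z.
  by move=> iK; rewrite nth_mkseq//; have := s_ge i iK; lia.
have st : sorted geq t.
  apply/(sortedP 0%N) => i; rewrite size_mkseq => iK /=.
  have := nth_t i (ltnW iK); have := nth_t i.+1 iK; have := s_lt i i.+1 (ltnSn i) iK.
  by rewrite /geq /=; lia.
(* Zero parts are dropped; reading past the end returns the default 0, so the beads are
   unchanged. *)
have la_proof : is_intpart (filter (leq 1) t).
  rewrite /is_intpart filter_all andbT; apply: sorted_filter st.
  exact: rev_trans leq_trans.
exists (IntPart la_proof).
have bead_s i : (i < K)%N -> bead (IntPart la_proof) i = nth 0 s i.
  by move=> iK; rewrite /bead /= nth_filter_gt0// nth_t// addrK.
have bead_l i : (K <= i)%N -> bead (IntPart la_proof) i = - i.+1%:Z.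
  by move=> iK; rewrite /bead /= nth_filter_gt0// nth_default ?size_mkseq//; lia.
rewrite beta_setE; apply/seteqP; split=> x /=.
- move=> [i ->]; have [iK|Ki] := ltnP i K.
    by rewrite bead_s//; have := s_mem i iK; rewrite mem_s => /andP[_ /set_mem].
  by rewrite bead_l//; apply: (XK _).1; lia.
- move=> Xx; have [xl|xl] := ltrP x (- K%:Z).
    by exists (absz (x + 1)); rewrite bead_l; lia.
  have xK : x < K%:Z by rewrite ltNge; apply/negP => h; apply: (XK x).2 Xx.
  have xs : x \in s by rewrite mem_s xl xK mem_set.
  exists (index x s); rewrite bead_s ?nth_index// -sz index_mem//.
Qed.

(** * Blocks in terms of beta-sets *)

Lemma gap_count_gaps X f x (n : nat) : gap_count X f ->
  (forall k : nat, (k < n)%N -> ~ X (x + k%:Z)) -> f (x + n%:Z) = f x + n%:Z.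
Proof.
move=> fX; elim: n => [|n IH] gaps; first by rewrite !addr0.
have -> : x + n.+1%:Z = x + n%:Z + 1 by lia.
rewrite fX IH ?ind0//; first by lia.
- exact: gaps.
- by move=> k kn; apply: gaps; apply: ltnW.
Qed.

Lemma bead_lt_iff la (i j : nat) : (bead la j < bead la i) = (i < j)%N.
Proof.
have [ij|ji|->] := ltngtP i j; first exact: bead_lt; last exact: ltxx.
by apply/negbTE; rewrite -leNgt ltW// bead_lt.
Qed.

(** The constant [f (bead la 0) - nth 0 la 0] is the value of [f] below all gaps; a bead has as many
    gaps below it as the size of its part. *)
Lemma gap_count_bead la f (i : nat) : gap_count (beta_set la) f ->
  f (bead la i) = f (bead la 0) - (nth 0%N la 0)%:Z + (nth 0%N la i)%:Z.
Proof.
move=> fX; elim: i => [|i IH]; first by rewrite subrK.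
have lt := bead_lt la (ltnSn i).
suff : f (bead la i) = f (bead la i.+1) + (bead la i - bead la i.+1 - 1).
  by rewrite IH /bead; lia.
have := @gap_count_gaps _ f (bead la i.+1 + 1) (absz (bead la i - bead la i.+1 - 1)%R) fX.
have -> : bead la i.+1 + 1 + (absz (bead la i - bead la i.+1 - 1)%R)%:Z = bead la i by lia.
rewrite fX (ind1 (beta_set_bead la i.+1)) => ->; first by lia.
move=> k kn; rewrite beta_setE /= => -[j Ej].
have : bead la j < bead la i by lia.
have : bead la i.+1 < bead la j by lia.
by rewrite !bead_lt_iff; lia.
Qed.

(** The gaps in increasing order, indexed from 0: the complement of the beta-set is described by the
    conjugate partition. *)
Definition gap la (c : nat) : int := c%:Z - (conj_part la c.+1)%:Z.

Lemma bead_gap la (c i : nat) :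
  if (i < conj_part la c.+1)%N then gap la c < bead la i else bead la i < gap la c.
Proof.
have := ltn_conj_part la i (ltn0Sn c); rewrite /gap /bead.
by case: ifP => h1 h2; lia.
Qed.

Lemma gapN la (c : nat) : ~ beta_set la (gap la c).
Proof.
by rewrite beta_setE => -[i E]; have := bead_gap la c i; rewrite -E ltxx; case: ifP.
Qed.

Lemma gap_count_gap la f (c : nat) : gap_count (beta_set la) f ->
  f (gap la c) = f (bead la 0) - (nth 0%N la 0)%:Z + c%:Z.
Proof.
move=> fX; set J := conj_part la c.+1.
have lt : bead la J < gap la c by have := bead_gap la c J; rewrite ltnn.
have := @gap_count_gaps _ f (bead la J + 1) (absz (gap la c - bead la J - 1)%R) fX.
have -> : bead la J + 1 + (absz (gap la c - bead la J - 1)%R)%:Z = gap la c by lia.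
rewrite fX (ind1 (beta_set_bead la J)) (gap_count_bead _ fX) => ->.
  by move: lt; rewrite /gap -/J /bead; lia.
move=> k kn; rewrite beta_setE /= => -[j Ej].
have := bead_gap la c j; case: ifP => h; first by lia.
have : bead la J < bead la j by lia.
by rewrite bead_lt_iff; move: h; rewrite -/J; lia.
Qed.

Lemma gap_surj la x : ~ beta_set la x -> exists c : nat, x = gap la c.
Proof.
move=> nx.
(* The least such [J] is the number of beads above [x], and the index of the gap is then [x + J]. *)
have ex : exists J, bead la J < x.
  by exists (size la + absz x)%N; rewrite bead_large; lia.
case: (ex_minnP ex) => J Jx Jmin.
have x_lt (k : nat) : (k < J)%N -> x < bead la k.
  move=> kJ; rewrite lt_neqAle; apply/andP; split.
    by apply/eqP => E; apply: nx; rewrite E; apply: beta_set_bead.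
  by rewrite leNgt; apply/negP => /Jmin; lia.
have c0 : 0 <= x + J%:Z by move: Jx; rewrite /bead; lia.
exists (absz (x + J%:Z)); rewrite /gap.
have -> : conj_part la (absz (x + J%:Z)).+1 = J; last by lia.
apply/eqP; rewrite eqn_leq; apply/andP; split.
  by rewrite leqNgt ltn_conj_part//; move: Jx; rewrite /bead; lia.
case: J {ex Jx Jmin} x_lt c0 => // J x_lt c0.
by rewrite ltn_conj_part//; have := x_lt J (ltnSn J); rewrite /bead; lia.
Qed.

(** Nodes correspond to pairs of a bead, for the row, and a lower gap, for the column. The hook
    length is their difference and the arm length the number of gaps strictly between. *)
Lemma balanced_bal (d e : nat) la : balanced d e la <-> bal d e (beta_set la).
Proof.
have hookE (i c : nat) : (c < nth 0 la i)%N ->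
    (hook la i.+1 c.+1)%:Z = bead la i - gap la c.
  move=> ci; have := ltn_conj_part la i (ltn0Sn c); rewrite ci => iJ.
  by rewrite /hook /arm /gap /bead /part /=; lia.
have [f fX] := gap_count_ex (beta_set la).
have armE (i c : nat) : (c < nth 0 la i)%N ->
    (arm la i.+1 c.+1)%:Z = f (bead la i) - f (gap la c) - 1.
  by move=> ci; rewrite (gap_count_bead _ fX) (gap_count_gap _ fX) /arm /part /=; lia.
split=> [bla|bX r c].
- apply: (balP fX) => b c; rewrite {1}beta_setE => -[i ->] /gap_surj[k ->] lt eh.
  have ki : (k < nth 0 la i)%N.
    by rewrite -ltn_conj_part//; have := bead_gap la k i; case: ifP => //; lia.
  rewrite -armE//; apply: bla; last by move: eh; rewrite -hookE.
  by rewrite /node /part /= -intpart_gt0 ki (leq_ltn_trans _ ki).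
- case: r => // i; case: c => [|k]; first by rewrite /node andbF.
  rewrite /node /part /= => /andP[_ ki] eh.
  have := bX f fX _ _ (beta_set_bead la i) (@gapN la k).
  rewrite -armE//; apply; last by rewrite -hookE.
  have := bead_gap la k i; case: ifP => //; rewrite ltn_conj_part//.
  by rewrite ki.
Qed.

(** * Bead moves and cores *)

Lemma bead_move_excess (e : nat) X Y : (0 < e)%N -> maya X -> bead_move e X Y ->
  maya Y /\ exists b, forall u, excess u Y X = u (b - e%:Z) - u b.
Proof.
move=> e0 [K XK] [b [Xb nXb ->]]; split.
  exists (K + e)%N => x; split=> h.
    have [E|xb] := eqVneq x b; first by exfalso; apply/nXb/(XK _).1; lia.
    by right; split; [apply (XK x).1; lia|exact/eqP].
  by move=> [/= E|[Xx _]]; [apply: (XK b).2 Xb; lia|apply: (XK x).2 Xx; lia].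
exists b => u; rewrite (@excess_delta 1 (fun=> b - e%:Z) (fun=> b)) ?big_ord1// => x.
rewrite big_ord1 /=; have [->|xb] := eqVneq x b.
  have E : (b == b - e%:Z) = false by apply/eqP; lia.
  by rewrite (ind1 Xb) E ind0// => -[/= F|[_ []//]]; move: E; rewrite -F eqxx.
have [->|xbe] := eqVneq x (b - e%:Z); first by rewrite (ind0 nXb) ind1//; left.
apply/eqP; rewrite subr_eq0; apply/eqP; apply: ind_iff; split.
  by move=> [/= E|[]//]; move: xbe; rewrite E eqxx.
by move=> Xx; right; split=> //; apply/eqP.
Qed.

Lemma runner_shift (e : nat) r b : runner e r (b - e%:Z) = runner e r b.
Proof.
rewrite /runner; congr (nat_of_bool _)%:Z; have ee : (e%:Z %| e%:Z)%Z by apply: dvdzz.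
by apply/idP/idP => h; [apply: dvdz_eqr (rpredD h ee) _|apply: dvdz_eqr (rpredB h ee) _]; lia.
Qed.

Lemma bead_moves_excess (e : nat) X Y : (0 < e)%N ->
  clos_refl_trans (set int) (bead_move e) X Y -> maya X ->
  maya Y /\ forall r, excess (runner e r) Y X = 0.
Proof.
move=> e0; elim=> {X Y} [X Y XY mX|X mX|X Y Z _ IH1 _ IH2 mX].
- have [mY [b H]] := bead_move_excess e0 mX XY; split=> // r.
  by rewrite H runner_shift subrr.
- by split=> // r; apply: excessxx.
- have [mY H1] := IH1 mX; have [mZ H2] := IH2 mY; split=> // r.
  by rewrite -(excess_trans _ mZ mY mX) H1 H2.
Qed.

Lemma ecore_setP (e : nat) X : (0 < e)%N ->
  ecore_set e X <-> forall Y, ~ bead_move e X Y.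
Proof.
move=> e0; split=> [cX Y [b [Xb nXb _]]|no x Xx]; first exact/nXb/cX.
by apply: contrapT => nX; apply: (no _ (ex_intro _ x (And3 Xx nX erefl))).
Qed.

(** A difference would give, on one runner, an element of [X] only and one of [Y] only; whichever is
    lower lies under a bead of the other set, and cores have no holes. *)
Lemma ecore_set_inj (e : nat) X Y : maya X -> maya Y -> ecore_set e X -> ecore_set e Y ->
  (forall r, excess (runner e r) X Y = 0) -> X = Y.
Proof.
move=> mX mY cX cY D0; apply: contrapT => ne.
have [x nex] : exists x, ind X x <> ind Y x.
  apply: contrapT => no; apply: ne; apply: eq_ind_set => x.
  by apply: contrapT => h; apply: no; exists x.
have xx : (e%:Z %| x - x)%Z by rewrite subrr dvdz0.
have [i [j [ii jj [Xi nYi] [Yj nXj]]]] :=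
  charge_neq mX mY (D0 x) (ex_intro2 _ _ x xx nex).
have ij : (e%:Z %| i - j)%Z by apply: on_sub ii jj.
have ji : (e%:Z %| j - i)%Z by apply: on_sub jj ii.
have [le|lt] := lerP i j; first exact/nYi/(ecore_set_le cY Yj le ji).
exact/nXj/(ecore_set_le cX Xi (ltW lt) ij).
Qed.

(** A function of the residue is a linear combination of the runner indicators. *)
Lemma excess_periodic (e : nat) (g : int -> int) X Y : (0 < e)%N -> maya X -> maya Y ->
  (forall r, excess (runner e r) X Y = 0) -> excess (fun x => g (x %% e%:Z)%Z) X Y = 0.
Proof.
move=> e0 mX mY D0.
pose F (i : nat) x := g i%:Z * runner e i%:Z x.
have -> : excess (fun x => g (x %% e%:Z)%Z) X Y = excess (fun x => \sum_(i < e) F i x) X Y.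
  apply: eq_excess => x _.
  have rx : (absz (x %% e%:Z)%Z < e)%N.
    by have := ltz_mod x (_ : e%:Z != 0); have := modz_ge0 x (_ : e%:Z != 0); lia.
  have rE : (absz (x %% e%:Z)%Z)%:Z = (x %% e%:Z)%Z.
    by have := modz_ge0 x (_ : e%:Z != 0); lia.
  rewrite (bigD1 (Ordinal rx))//= big1 ?addr0.
    by rewrite /F /runner rE -eqz_mod_dvd modz_mod eqxx mulr1.
  move=> i ne; rewrite /F /runner -eqz_mod_dvd; case: eqP => [E|_]; last by rewrite mulr0.
  exfalso; move/eqP: ne; apply; apply: val_inj => /=.
  by rewrite E modz_small//; have := ltn_ord i; lia.
rewrite (excess_sum e F)// big1// => i _.
by rewrite excessZ// D0 mulr0.
Qed.

(** Induction on the size. A move preserves charge and runner counts, so it yields the beta-set of a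
    smaller partition; when no move is left, the set is a core with the runner counts of [mu], hence
    that of [mu]. *)
Lemma reach_core (e : nat) la mu : (0 < e)%N -> ecore_set e (beta_set mu) ->
  (forall r, excess (runner e r) (beta_set la) (beta_set mu) = 0) ->
  clos_refl_trans (set int) (bead_move e) (beta_set la) (beta_set mu).
Proof.
move=> e0 cmu; have [n] := ubnP (psize la); elim: n la => // n IH la la_n D0.
have [mX mM] := (maya_beta_set la, maya_beta_set mu).
have mv : maya vacuum := maya_lt 0.
have [[Y XY]|no] := pselect (exists Y, bead_move e (beta_set la) Y); last first.
  have cX : ecore_set e (beta_set la).
    by apply/ecore_setP => // Y XY; apply: no; exists Y.
  by rewrite (ecore_set_inj mX mM cX cmu D0); apply: rt_refl.
have [mY [b H]] := bead_move_excess e0 mX XY.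
have [nu Enu] : exists nu, beta_set nu = Y.
  apply: beta_set_surj => //.
  by rewrite -(excess_trans _ mY mX mv) H subrr excess_beta_set_vacuum.
apply: rt_trans (rt_step _ _ _ _ XY) _; rewrite -Enu; apply: IH.
  have := excess_trans id mY mX mv; rewrite H -Enu !psize_excess /=; lia.
by move=> r; rewrite Enu -(excess_trans _ mY mX mM) D0 H runner_shift subrr.
Qed.

Lemma block_excess (e w : nat) la mu : (0 < e)%N -> is_ecore e mu ->
  block e mu w la <-> (forall r, excess (runner e r) (beta_set la) (beta_set mu) = 0) /\
    excess id (beta_set la) (beta_set mu) = w%:Z * e%:Z.
Proof.
move=> e0 [_ nomove].
have [mX mM] := (maya_beta_set la, maya_beta_set mu).
have mv : maya vacuum := maya_lt 0.
have := excess_trans id mX mM mv; rewrite !psize_excess => size_eq.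
split=> [[[moves _] szE]|[D0 wE]].
- have [_ H] := bead_moves_excess e0 moves mX.
  split; last by move: size_eq; rewrite szE PoszD PoszM; lia.
  by move=> r; rewrite excessC// H oppr0.
- split; last by apply/eqP; rewrite -eqz_nat PoszD PoszM; lia.
  by split=> //; apply: reach_core => //; apply/ecore_setP.
Qed.

Lemma block_balanced_card (d e w : nat) mu : (0 < e)%N -> is_ecore e mu ->
  block e mu w `&` [set la | balanced d e la] #= bal_block d e (beta_set mu) w.
Proof.
move=> e0 cmu.
have -> : bal_block d e (beta_set mu) w =
    beta_set @` (block e mu w `&` [set la | balanced d e la]).
  apply/seteqP; split=> X.
    move=> [mX bX D0 wX].
    have [mM mv] := (maya_beta_set mu, maya_lt 0 : maya vacuum).
    have [la Ela] : exists la, beta_set la = X.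
      apply: beta_set_surj => //.
      rewrite -(excess_trans _ mX mM mv) excess_beta_set_vacuum addr0.
      exact: (excess_periodic (fun=> 1) e0 mX mM D0).
    exists la => //; rewrite -Ela in bX D0 wX.
    by split; [apply/block_excess|apply/balanced_bal].
  move=> [la [/(block_excess _ _ e0 cmu)[D0 wX] /balanced_bal bX] <-].
  by split=> //; apply: maya_beta_set.
by rewrite card_eq_sym; apply: inj_card_eq => la nu _ _ /beta_set_inj.
Qed.

(** * Well separated runners *)

Implicit Types (s j l : int).

Lemma gap_count_beads X f x (n : nat) : gap_count X f ->
  (forall k : nat, (k < n)%N -> X (x + k%:Z)) -> f (x + n%:Z) = f x.
Proof.
move=> fX; elim: n => [|n IH] beads; first by rewrite !addr0.
have -> : x + n.+1%:Z = x + n%:Z + 1 by lia.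
rewrite fX IH ?ind1//; first by lia.
- exact: beads.
- by move=> k kn; apply: beads; apply: ltnW.
Qed.

Section Rock.
Variables (e w : nat) (k : int -> int).

Definition pos r j : int := r + j * e%:Z.

Lemma pos_on r j : (e%:Z %| pos r j - r)%Z.
Proof. by rewrite /pos addrAC subrr add0r dvdz_mull. Qed.

Lemma runner_pos r j s : runner e s (pos r j) = runner e s r.
Proof.
rewrite /runner; congr (nat_of_bool _)%:Z; have h := pos_on r j.
by apply/idP/idP => h'; [apply: dvdz_eqr (rpredB h' h) _|apply: dvdz_eqr (rpredD h' h) _]; lia.
Qed.

Hypothesis e_gt0 : (0 < e)%N.

Lemma pos_div r j : 0 <= r < e%:Z -> (pos r j %/ e%:Z)%Z = j.
Proof.
move=> re; rewrite /pos addrC divzMDl; last by lia.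
by rewrite divz_small ?addr0//; lia.
Qed.

Lemma pos_mod r j : 0 <= r < e%:Z -> (pos r j %% e%:Z)%Z = r.
Proof. by move=> re; rewrite /pos addrC modzMDl modz_small. Qed.

Lemma posP x : exists r j, 0 <= r < e%:Z /\ x = pos r j.
Proof.
exists (x %% e%:Z)%Z, (x %/ e%:Z)%Z; split.
  have e0 : e%:Z != 0 by lia.
  by have := modz_ge0 x e0; have := ltz_mod x e0; lia.
by rewrite {1}(divz_eq x e%:Z) addrC.
Qed.

Lemma pos_inj r j s l : 0 <= r < e%:Z -> 0 <= s < e%:Z -> pos r j = pos s l ->
  r = s /\ j = l.
Proof.
move=> re se E; split; first by rewrite -(pos_mod j re) E pos_mod.
by rewrite -(pos_div j re) E pos_div.
Qed.

Lemma pos_dvd r j s l : 0 <= r < e%:Z -> 0 <= s < e%:Z ->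
  (e%:Z %| pos r j - pos s l)%Z = (r == s).
Proof.
by move=> re se; rewrite -eqz_mod_dvd !pos_mod.
Qed.

(* The core whose runner [r] is filled below height [k r]. *)
Definition flush : set int := [set x | (x %/ e%:Z)%Z < k (x %% e%:Z)%Z].

Lemma flush_pos r j : 0 <= r < e%:Z -> flush (pos r j) = (j < k r) :> Prop.
Proof. by move=> re; rewrite /flush /= pos_div// pos_mod. Qed.

Lemma ecore_flush : ecore_set e flush.
Proof.
move=> x; have [r [j [re ->]]] := posP x.
have -> : pos r j - e%:Z = pos r (j - 1) by rewrite /pos; lia.
by rewrite !flush_pos//; lia.
Qed.

Lemma maya_flush (B : nat) : (forall r, 0 <= r < e%:Z -> - B%:Z <= k r <= B%:Z) -> maya flush.
Proof.
move=> kB; exists (B.+1 * e)%N => x; have [r [j [re ->]]] := posP x.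
rewrite flush_pos//; have := kB r re; rewrite /pos => kBr.
by split=> h; nia.
Qed.

Definition windowed X := forall r j, 0 <= r < e%:Z ->
  (j < k r - w%:Z -> X (pos r j)) /\ (k r + w%:Z < j -> ~ X (pos r j)).

(** Let [u] be the height above the surface of [flush]. Since [e * u] differs from the identity by a
    periodic function, the total excess of [u] is [w]; all its terms are nonnegative, so each is at
    most [w]. *)
Lemma weight_windowed X : maya flush -> maya X ->
  (forall r, excess (runner e r) X flush = 0) -> excess id X flush = w%:Z * e%:Z ->
  windowed X.
Proof.
move=> mG mX D0 wX.
pose g r := - r - e%:Z * k r.
pose u x := (x %/ e%:Z)%Z - k (x %% e%:Z)%Z.
have uw : excess u X flush = w%:Z.
  apply/(@mulfI _ e%:Z); first by lia.
  rewrite -excessZ// mulrC -wX.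
  have -> : excess (fun x => e%:Z * u x) X flush =
      excess (fun x => id x + g (x %% e%:Z)%Z) X flush.
    apply: eq_excess => x _; rewrite /u /g /=.
    by rewrite [in X in _ = X + _](divz_eq x e%:Z); ring.
  by rewrite excessD// (excess_periodic g)// addr0.
have u_ge0 x : 0 <= u x * (ind X x - ind flush x).
  by rewrite /u; case: (indP X x) => _; case: (indP flush x); rewrite /flush /=; lia.
move=> r j re; have := excess_ge (pos r j) mX mG u_ge0; rewrite uw /u pos_div// pos_mod//.
by case: (indP X) => Xr; case: (indP flush); rewrite flush_pos// => h1 h2; split=> //; lia.
Qed.

Hypothesis k_gap : forall r s, 0 <= r < s -> s < e%:Z -> k r + w.*2%:Z + 2 <= k s.

(* Near height [k r], the lower runners are empty and the higher ones full. *)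
Lemma gap_count_period X f r j : windowed X -> gap_count X f -> 0 <= r < e%:Z ->
  k r - w%:Z <= j <= k r + w%:Z ->
  f (pos r (j + 1)) = f (pos r j) + r + (1 - ind X (pos r j)).
Proof.
move=> wX fX re jw; set x := pos r j.
(* Between the two ends lie first the higher runners at height [j], all beads, then the [r] lower
   runners at height [j + 1], all gaps. *)
have E1 : x + 1 + (absz (e%:Z - 1 - r)%R)%:Z + (absz r)%:Z = pos r (j + 1).
  by rewrite /x /pos; lia.
rewrite -E1 (gap_count_gaps (X := X))//; last first.
  move=> i ir; have -> : x + 1 + (absz (e%:Z - 1 - r)%R)%:Z + i%:Z = pos i%:Z (j + 1).
    by rewrite /x /pos; lia.
  have ie : 0 <= i%:Z < e%:Z by lia.
  by have := @k_gap i%:Z r; have [_ h] := wX _ (j + 1) ie => h'; apply: h; lia.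
rewrite (gap_count_beads (X := X))//; first by rewrite fX; lia.
move=> i ir; have -> : x + 1 + i%:Z = pos (r + 1 + i%:Z) j by rewrite /x /pos; lia.
have ie : 0 <= r + 1 + i%:Z < e%:Z by lia.
by have := @k_gap r (r + 1 + i%:Z); have [h _] := wX _ j ie => h'; apply: h; lia.
Qed.

(** When [d] divides [r], climbing one level past a bead changes [f] by a multiple of [d]; only the
    starting position can contribute 1. *)
Lemma gap_count_chain (d : nat) X f r j (n : nat) : windowed X -> gap_count X f ->
  0 <= r < e%:Z -> (d %| r)%Z -> k r - w%:Z <= j -> j + n%:Z <= k r + w%:Z + 1 -> (0 < n)%N ->
  (forall l, j < l < j + n%:Z -> X (pos r l)) ->
  (d %| f (pos r (j + n%:Z)) - f (pos r j) - (1 - ind X (pos r j)))%Z.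
Proof.
move=> wX fX re dr jk; elim: n => // -[_|n IH] jn _ beads.
  by rewrite (gap_count_period wX fX re); [apply: dvdz_eqr dr _|]; lia.
have -> : j + n.+2%:Z = j + n.+1%:Z + 1 by lia.
rewrite (gap_count_period wX fX re); last by lia.
rewrite (ind1 (beads _ _)); last by lia.
have h : (d %| f (pos r (j + n.+1%:Z)) - f (pos r j) - (1 - ind X (pos r j)))%Z.
  by apply: IH => // [|l lj]; [lia|apply: beads; lia].
by apply: dvdz_eqr (rpredD h dr) _; lia.
Qed.

(** Let [g] and [m] be the two lowest gaps of the runner. Balance forbids beads above [m], and the
    number of beads forces [m - 1 = k r]. The case [g = k r] is a runner without a hole. *)
Lemma bal_runner (d : nat) X r : (1 < d)%N -> maya flush -> 0 <= r < e%:Z ->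
  bal_block d e flush w X ->
  exists g, [/\ g <= k r, k r - w%:Z <= g, g < k r -> (d %| r)%Z &
    forall j, X (pos r j) <-> j <= k r /\ j <> g].
Proof.
move=> d1 mG re [mX bX D0 wtX].
have wX := weight_windowed mG mX D0 wtX.
have [f fX] := gap_count_ex X.
have bal_r j l : X (pos r l) -> ~ X (pos r j) -> j < l ->
    (d %| f (pos r l) - f (pos r j) - 1)%Z.
  move=> Xl Xj jl; apply: bX => //; first by rewrite /pos; nia.
  by rewrite pos_dvd.
have lo j : ~ X (pos r j) -> k r - w%:Z <= j.
  by move=> nX; rewrite leNgt; apply/negP => lt; apply/nX/(wX r j re).1.
have hi j : X (pos r j) -> j <= k r + w%:Z.
  by move=> Xj; rewrite leNgt; apply/negP => lt; apply: (wX r j re).2 Xj.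
have gap_hi : ~ X (pos r (k r + w%:Z + 1)) by move=> /hi; lia.
have [g nXg gmin] := int_has_min gap_hi lo.
have [||m [nXm gm] mmin] := @int_has_min (fun j => ~ X (pos r j) /\ g < j) g
  (k r + w%:Z + 1 + (absz g)%:Z + 1 + (absz (k r))%:Z).
- split; last by lia.
  by move=> /hi; lia.
- by move=> j [_ /ltW].
have between l : g < l < m -> X (pos r l).
  move=> /andP[gl lm]; apply: contrapT => nX; have := mmin l (conj nX gl); lia.
have adjacent j : ~ X (pos r j) -> X (pos r (j + 1)) -> (d %| r)%Z.
  move=> nXj Xj1; have := bal_r j (j + 1) Xj1 nXj.
  rewrite (gap_count_period wX fX re); last by have := lo _ nXj; have := hi _ Xj1; lia.
  rewrite (ind0 nXj) => h; apply: dvdz_eqr (h _) _; lia.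
(* The least bead above [m] follows a gap, so [d] divides [r]. Compared with the gaps [g] and [m] it
   gives [f m = f g] modulo [d], while the beads between [g] and [m] give [f m = f g + 1]. *)
have above l : m <= l -> ~ X (pos r l).
  move=> ml Xl.
  have lm j : X (pos r j) /\ m <= j -> m <= j by case.
  have [b [Xb mb] bmin] := @int_has_min (fun j => X (pos r j) /\ m <= j) m l (conj Xl ml) lm.
  have mb' : m <> b by move=> E; rewrite E in nXm.
  have mb1 : m <= b - 1 by lia.
  have nXb1 : ~ X (pos r (b - 1)) by move=> h; have := bmin (b - 1) (conj h mb1); lia.
  have dr : (d %| r)%Z by apply: (adjacent (b - 1)); rewrite ?subrK.
  have h1 := bal_r g b Xb nXg; have h2 := bal_r m b Xb nXm.
  have mE : m = g + (absz (m - g)%R)%:Z by lia.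
  have := @gap_count_chain d X f r g (absz (m - g)%R) wX fX re dr (lo _ nXg).
  rewrite -mE (ind0 nXg) => h3.
  have h4 : (d %| f (pos r m) - f (pos r g))%Z.
    by apply: dvdz_eqr (rpredB (h1 _) (h2 _)) _; lia.
  apply: (dvdz_gt1 d1 h4); apply: dvdz_eqr (h3 _ _ _) _ => //; try lia.
  by have := hi _ Xb; lia.
have XE j : X (pos r j) <-> j <= m - 1 /\ j <> g.
  split=> [Xj|[jm jg]].
    split; last by move=> E; rewrite E in Xj.
    by rewrite leNgt; apply/negP => lt; apply: (above j _ Xj); lia.
  have [jg'|gj] := ltrP j g; last by apply: between; lia.
  by apply: contrapT => /gmin; lia.
suff mk : m - 1 = k r.
  exists g; rewrite -mk; split=> //; [lia|by rewrite mk; apply: lo|].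
  move=> gm1; apply: (adjacent g) => //; apply: between; lia.
(* [Y] fills the hole [g] with the top bead [m - 1]: its runner [r] is everything below [m - 1],
   with the same number of beads, and can be compared with that of [flush]. *)
pose Y : set int := [set x | if (x %% e%:Z)%Z == r then (x %/ e%:Z)%Z < m - 1 else x \in X].
have Yr j : Y (pos r j) = (j < m - 1) :> Prop.
  by rewrite /Y /= pos_mod// eqxx pos_div.
have Yne s j : 0 <= s < e%:Z -> s != r -> Y (pos s j) = X (pos s j).
  by move=> se /negPf sr; rewrite /Y /= pos_mod// sr in_setE.
have mY : maya Y.
  have [K XK] := mX; exists (K + (absz m).+1 * e)%N => x.
  have [s [j [se ->]]] := posP x; have [h1 h2] := XK (pos s j).
  have [->|sr] := eqVneq s r; last first.
    by rewrite Yne//; split=> h; [apply: h1|apply: h2]; lia.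
  by rewrite Yr /pos; split=> h; nia.
have YX : excess (runner e r) Y X = 0.
  rewrite (@excess_delta 1 (fun=> pos r g) (fun=> pos r (m - 1))); last first.
    move=> x; have [s [j [se ->]]] := posP x; rewrite big_ord1 /=.
    have posE l : (pos s j == pos r l) = (s == r) && (j == l).
      by apply/eqP/andP => [/(pos_inj se re)[-> ->]|[/eqP -> /eqP ->]].
    rewrite !posE; have [Es|sr] := eqVneq s r; last first.
      by rewrite (@ind_iff Y X _ (pos s j)) ?subrr// Yne.
    rewrite Es; have Xj := XE j.
    by case: (indP X) => [/Xj|h1 {Xj}]; [|have : ~ (j <= m - 1 /\ j <> g) by move/XE];
      case: (indP Y); rewrite Yr => h2 h3 /=; lia.
  by rewrite big_ord1 /= !runner_pos subrr.
have YG : excess (runner e r) Y flush = 0 by rewrite -(excess_trans _ mY mX mG) YX D0.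
apply: contrapT => ne.
have [|i [j [ii jj]]] := charge_neq mY mG YG.
  have [lt|gt] : m - 1 < k r \/ k r < m - 1 by lia.
    exists (pos r (m - 1)); first exact: pos_on.
    by rewrite ind0 ?ind1//; rewrite ?flush_pos// Yr ltxx.
  exists (pos r (k r)); first exact: pos_on.
  by rewrite ind1 ?ind0//; rewrite ?flush_pos ?ltxx// Yr.
have onr s l : 0 <= s < e%:Z -> (e%:Z %| pos s l - r)%Z -> s = r.
  by move=> se h; apply/eqP; rewrite -(pos_dvd l 0 se re);
    apply: dvdz_eqr h _; rewrite /pos; lia.
have [si [li [sie Ei]]] := posP i; have [sj [lj [sje Ej]]] := posP j.
rewrite Ei in ii *; rewrite Ej in jj *.
have Esi := onr _ _ sie ii; have Esj := onr _ _ sje jj.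
rewrite Esi Esj !flush_pos// !Yr; lia.
Qed.
End Rock.

(** * The balanced sets over separated runners and their number *)

Section Columns.
Variables (d e w : nat) (k : int -> int).
Hypothesis e_gt0 : (0 < e)%N.
Hypothesis d_gt0 : (0 < d)%N.

Local Notation pos := (pos e).
Local Notation flush := (flush e k).
Local Notation m := ((e - 1) %/ d)%N.

Definition height (t : nat -> nat) r : int :=
  if (d%:Z %| r)%Z then (t (absz r %/ d)%N)%:Z else 0.

(* [flush] with, on each runner [r] divisible by [d], the bead at height [k r - height t r]
   moved up to height [k r]. *)
Definition columns (t : nat -> nat) : set int := [set x |
  (x %/ e%:Z)%Z <= k (x %% e%:Z)%Z /\
  (x %/ e%:Z)%Z <> k (x %% e%:Z)%Z - height t (x %% e%:Z)%Z].

Lemma columns_pos t r j : 0 <= r < e%:Z ->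
  columns t (pos r j) = (j <= k r /\ j <> k r - height t r) :> Prop.
Proof. by move=> re; rewrite /columns /= pos_div// pos_mod. Qed.

(** The multiples of [d] among the residues are the [d * i] with [i] at most the floor of
    [(e - 1) / d]; this is the source of the [m.+1] free depths. *)
Lemma mul_residue (i : nat) : (i < m.+1)%N -> 0 <= (d * i)%:Z < e%:Z.
Proof.
move=> im; have : (i * d <= e - 1)%N by rewrite -leq_divRL.
by rewrite mulnC; lia.
Qed.

Lemma height_mul t (i : nat) : height t (d * i)%:Z = t i.
Proof. by rewrite /height PoszM dvdz_mulr ?dvdzz// -PoszM /= mulKn. Qed.

Lemma multiple_residue r : 0 <= r < e%:Z -> (d%:Z %| r)%Z ->
  exists2 i : nat, (i < m.+1)%N & r = (d * i)%:Z.
Proof.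
move=> re /dvdzP[q Eq]; have q0 : 0 <= q by nia.
exists (absz q); last by rewrite Eq PoszM; lia.
rewrite ltnS leq_divRL//; nia.
Qed.

Lemma columns_flush t x : ind (columns t) x - ind flush x =
  \sum_(i < m.+1) ((x == pos (d * i)%:Z (k (d * i)%:Z))%:Z
    - (x == pos (d * i)%:Z (k (d * i)%:Z - (t i)%:Z))%:Z).
Proof.
have [r [j [re ->]]] := posP e_gt0 x.
have posE s l : 0 <= s < e%:Z -> (pos r j == pos s l) = (r == s) && (j == l).
  by move=> se; apply/eqP/andP => [/(pos_inj e_gt0 re se)[-> ->]|[/eqP -> /eqP ->]].
have [dr|dr] := boolP (d%:Z %| r)%Z; last first.
  rewrite big1 => [|i _]; last first.
    rewrite !posE ?mul_residue// (_ : r == (d * i)%:Z = false)//.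
    by apply/eqP => E; move: dr; rewrite E PoszM dvdz_mulr.
  apply/eqP; rewrite subr_eq0; apply/eqP; apply: ind_iff.
  by rewrite columns_pos// flush_pos// /height (negPf dr); lia.
have [i im Er] := multiple_residue re dr.
rewrite (bigD1 (Ordinal im))//= big1 ?addr0 => [|i' ne]; last first.
  rewrite !posE ?mul_residue// (_ : r == (d * i')%:Z = false)//.
  apply/eqP; rewrite Er => -[] /eqP; rewrite eqn_pmul2l// => /eqP E.
  by move/eqP: ne; apply; apply: val_inj.
rewrite !posE ?mul_residue// Er eqxx /=; rewrite Er in re.
case: (indP (columns t)); rewrite columns_pos// height_mul => h1;
  case: (indP flush); rewrite flush_pos// => h2; lia.
Qed.

Lemma excess_columns u t : excess u (columns t) flush =
  \sum_(i < m.+1) (u (pos (d * i)%:Z (k (d * i)%:Z))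
     - u (pos (d * i)%:Z (k (d * i)%:Z - (t i)%:Z))).
Proof.
exact: (excess_delta (p := fun i => pos (d * i)%:Z (k (d * i)%:Z))
  (q := fun i => pos (d * i)%:Z (k (d * i)%:Z - (t i)%:Z)) u (columns_flush t)).
Qed.

Lemma excess_columns_id t :
  excess id (columns t) flush = (\sum_(i < m.+1) t i)%N%:Z * e%:Z.
Proof.
rewrite excess_columns (big_morph Posz PoszD (erefl : Posz 0 = 0)) mulr_suml.
by apply: eq_bigr => i _; rewrite /pos /=; lia.
Qed.

Lemma columns_inj t t' : columns t = columns t' -> forall i : nat, (i < m.+1)%N -> t i = t' i.
Proof.
move=> E i im; have re := mul_residue im.
have H j : (j <= k (d * i)%:Z /\ j <> k (d * i)%:Z - (t i)%:Z) <->
           (j <= k (d * i)%:Z /\ j <> k (d * i)%:Z - (t' i)%:Z).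
  by have := columns_pos t j re; have := columns_pos t' j re; rewrite !height_mul E => -> ->.
have := H (k (d * i)%:Z - (t i)%:Z); have := H (k (d * i)%:Z - (t' i)%:Z).
lia.
Qed.

Lemma maya_columns (B : nat) t : (forall r, 0 <= r < e%:Z -> - B%:Z <= k r <= B%:Z) ->
  (forall i : nat, (i < m.+1)%N -> (t i <= w)%N) -> maya (columns t).
Proof.
move=> kB tw; exists ((B + w).+2 * e)%N => x; have [r [j [re ->]]] := posP e_gt0 x.
rewrite columns_pos//; have kBr := kB r re.
have : 0 <= height t r <= w%:Z.
  rewrite /height; case: ifP => // /(multiple_residue re)[i im ->] /=.
  by rewrite mulKn//; have := tw i im; lia.
by rewrite /pos => hr; split=> h; nia.
Qed.

Hypothesis k_gap : forall r s, 0 <= r < s -> s < e%:Z -> k r + w.*2%:Z + 2 <= k s.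

(** The only gap lying under a bead of its own runner is the hole. Its runner is divisible by [d]
    and carries only beads from the hole up to the given bead, so [gap_count_chain] applies. *)
Lemma bal_block_columns (B : nat) (t : nat -> nat) :
  (forall r, 0 <= r < e%:Z -> - B%:Z <= k r <= B%:Z) ->
  (\sum_(i < m.+1) t i = w)%N -> bal_block d e flush w (columns t).
Proof.
move=> kB tw; have t_le (i : nat) : (i < m.+1)%N -> (t i <= w)%N.
  by move=> im; rewrite -tw (bigD1 (Ordinal im))//= leq_addr.
have mX := maya_columns kB t_le; have mG := maya_flush e_gt0 kB.
have D0 r : excess (runner e r) (columns t) flush = 0.
  by rewrite excess_columns big1// => i _; rewrite !runner_pos subrr.
have wX : excess id (columns t) flush = w%:Z * e%:Z by rewrite excess_columns_id tw.
split=> //; have [f fX] := gap_count_ex (columns t); apply: (balP fX) => b c.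
have [r [j [re ->]]] := posP e_gt0 b; have [s [l [se ->]]] := posP e_gt0 c.
move=> Xb Xc cb; rewrite pos_dvd// => /eqP E; rewrite -{s}E in se Xc cb *.
have lj : l < j by move: cb; rewrite /pos; nia.
have [jk jh] : j <= k r /\ j <> k r - height t r by move: Xb; rewrite columns_pos.
have lE : l = k r - height t r.
  by apply: contrapT => ne; apply: Xc; rewrite columns_pos//; lia.
have dr : (d%:Z %| r)%Z by apply: contrapT => /negP dr; move: lE; rewrite /height (negPf dr); lia.
have hw : height t r <= w%:Z.
  by have [i im ->] := multiple_residue re dr; rewrite height_mul; have := t_le i im; lia.
have windX := weight_windowed e_gt0 mG mX D0 wX.
have jE : j = l + (absz (j - l))%:Z by lia.
have := gap_count_chain (n := absz (j - l)) e_gt0 k_gap windX fX re dr (_ : k r - w%:Z <= l).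
rewrite -jE (ind0 Xc) => h; apply: dvdz_eqr (h _ _ _ _) _ => //; try lia.
by move=> i lij; rewrite columns_pos//; lia.
Qed.

Lemma bal_block_columnsP (B : nat) X : (1 < d)%N ->
  (forall r, 0 <= r < e%:Z -> - B%:Z <= k r <= B%:Z) -> bal_block d e flush w X ->
  exists t : nat -> nat, [/\ (\sum_(i < m.+1) t i = w)%N, forall i, (t i <= w)%N & X = columns t].
Proof.
move=> d1 kB bX; have mG := maya_flush e_gt0 kB.
have ex r : exists g, 0 <= r < e%:Z -> [/\ g <= k r, k r - w%:Z <= g, g < k r -> (d %| r)%Z &
    forall j, X (pos r j) <-> j <= k r /\ j <> g].
  have [re|re] := boolP (0 <= r < e%:Z); last by exists 0.
  by have [g gP] := bal_runner e_gt0 k_gap d1 mG re bX; exists g.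
have [g gP] := choice ex.
(* The depth of the hole below [k r]; the value 0 past the last index makes the bound by [w] hold
   for every [i]. *)
pose t (i : nat) := if (i < m.+1)%N then absz (k (d * i)%:Z - g (d * i)%:Z) else 0%N.
have hE r : 0 <= r < e%:Z -> k r - height t r = g r.
  move=> re; have [gk gw gd _] := gP r re; rewrite /height.
  have [/(multiple_residue re)[i im Er]|/negP ndr] := boolP (d%:Z %| r)%Z.
    by rewrite {2}Er /= mulKn// /t im -Er; lia.
  by have [/gd//|] := ltrP (g r) (k r); lia.
have XE : X = columns t.
  apply/seteqP; split=> x; have [r [j [re ->]]] := posP e_gt0 x;
    have [_ _ _ XrE] := gP r re; by rewrite columns_pos// hE// XrE.
exists t; split=> //.
- have [_ _ _] := bX; rewrite XE excess_columns_id.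
  have e0 : e%:Z != 0 by lia.
  by move=> /(mulIf e0) [].
- move=> i; rewrite /t; case: ifP => // im.
  by have [gk gw _ _] := gP _ (mul_residue im); lia.
Qed.

(** The depths form a weak composition of [w] into [m.+1] parts. No part exceeds [w], so tuples over
    ['I_w.+1] capture all of them. *)
Lemma bal_block_flush_card (B : nat) : (1 < d)%N ->
  (forall r, 0 <= r < e%:Z -> - B%:Z <= k r <= B%:Z) ->
  bal_block d e flush w #= `I_('C(w + m, w)).
Proof.
move=> d1 kB.
pose A := [set t : m.+1.-tuple 'I_w.+1 | (\sum_(i <- t) i == w)%N]%SET.
pose val_of (t : m.+1.-tuple 'I_w.+1) (i : nat) : nat := nth ord0 t i.
have sum_val t : (\sum_(i < m.+1) val_of t i = \sum_(i <- t) i)%N.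
  by rewrite (big_nth ord0) big_mkord size_tuple.
have <- : #|A| = 'C(w + m, w).
  by rewrite card_ord_partitions -[RHS]bin_sub ?leq_addr// addKn addnC.
pose F (i : 'I_#|A|) := columns (val_of (enum_val i)).
have Finj : {in [set: 'I_#|A|] &, injective F}.
  move=> i j _ _ /columns_inj E; apply: enum_val_inj; apply: eq_from_tnth => l.
  by apply: val_inj; rewrite !(tnth_nth ord0); apply: E.
have -> : bal_block d e flush w = F @` [set: 'I_#|A|].
  apply/seteqP; split=> X.
    move=> /(bal_block_columnsP d1 kB)[t [tw t_le ->]].
    pose s := [tuple inord (t i) : 'I_w.+1 | i < m.+1].
    have sE (i : nat) : (i < m.+1)%N -> val_of s i = t i.
      move=> im; rewrite /val_of (_ : nth ord0 s i = tnth s (Ordinal im)).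
        by rewrite tnth_mktuple inordK// ltnS.
      by rewrite (tnth_nth ord0).
    have sA : s \in A.
      by rewrite inE -sum_val -[X in _ == X]tw; apply/eqP/eq_bigr => i _; apply: sE.
    exists (enum_rank_in sA s) => //; rewrite /F enum_rankK_in//.
    apply/seteqP; split=> x; have [r [j [re ->]]] := posP e_gt0 x;
      rewrite !columns_pos// /height; case: ifP => // /(multiple_residue re)[i im ->];
      by rewrite /= mulKn// sE.
  move=> [i _ <-]; apply: (bal_block_columns kB); rewrite sum_val.
  by have := enum_valP i; rewrite inE => /eqP.
apply: card_eq_trans (inj_card_eq Finj) _.
by rewrite card_eq_sym; apply: card_II.
Qed.
End Columns.

(** The reflection of positions about -1/2 exchanges each of the two sets with its complement, so
    the relative charge equals its own negative. *)
Lemma excess_flush_vacuum (e : nat) (k : int -> int) : (0 < e)%N -> maya (flush e k) ->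
  (forall r, 0 <= r < e%:Z -> k (e%:Z - 1 - r) = - k r) ->
  excess (fun=> 1) (flush e k) vacuum = 0.
Proof.
move=> e0 mG kN; pose rho x := - 1 - x : int.
have rhoK : involutive rho by move=> x; rewrite /rho; lia.
have indN x : ind (flush e k) (rho x) = 1 - ind (flush e k) x.
  have [r [j [re ->]]] := posP e0 x.
  have -> : rho (pos e r j) = pos e (e%:Z - 1 - r) (- 1 - j) by rewrite /rho /pos; lia.
  have re' : 0 <= e%:Z - 1 - r < e%:Z by lia.
  by case: indP; rewrite flush_pos// kN// => h1; case: indP; rewrite flush_pos// => h2; lia.
have indN0 x : ind vacuum (rho x) = 1 - ind vacuum x.
  by rewrite /vacuum /rho; case: indP => /= h1; case: indP => /= h2; lia.
have mv : maya vacuum := maya_lt 0.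
suff : excess (fun=> 1) (flush e k) vacuum = excess (fun=> 1) vacuum (flush e k).
  by have := excessC (fun=> 1) mG mv; lia.
rewrite {1}/excess (reindex_fsbigT _ _ (inv_bij rhoK)).
by apply: eq_fsbigr => x _; rewrite indN indN0; lia.
Qed.

(** Both [G] and a well separated core are compared with the empty core, which transfers the count
    from the latter to the former. *)
Lemma bal_block_card (d e w : nat) G : (1 < d)%N -> (1 < e)%N -> maya G -> ecore_set e G ->
  excess (fun=> 1) G vacuum = 0 ->
  bal_block d e G w #= `I_('C(w + (e - 1) %/ d, w)).
Proof.
move=> d1 e1 mG cG G0; have e0 : (0 < e)%N := ltnW e1.
(* Neighbouring runners differ by [2 * (w + 1)], exactly the separation demanded by [k_gap];
   centring at [(e - 1) / 2] gives charge zero. *)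
pose k r : int := (2 * r - (e%:Z - 1)) * w.+1%:Z.
have kB r : 0 <= r < e%:Z -> - (e * w.+1)%N%:Z <= k r <= (e * w.+1)%N%:Z.
  by move=> re; rewrite /k PoszM; nia.
have k_gap r s : 0 <= r < s -> s < e%:Z -> k r + w.*2%:Z + 2 <= k s.
  by move=> rs se; rewrite /k -muln2 PoszM; nia.
have mK := maya_flush e0 kB.
apply: card_eq_trans (bal_block_vacuum w d1 e1 mG cG G0) _.
apply: card_eq_trans (bal_block_flush_card e0 (ltnW d1) k_gap d1 kB).
rewrite card_eq_sym; apply: bal_block_vacuum => //; first exact: ecore_flush.
apply: excess_flush_vacuum => // r re.
by rewrite /k; lia.
Qed.

Local Open Scope nat_scope.

Theorem corollary5p8 (d e w : nat) (ga : intpart)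
    (hd : 1 < d) (he : 1 < e) (hga : is_ecore e ga) :
  block e ga w `&` [set la | balanced d e la] #= `I_('C(w + (e - 1) %/ d, w)).
Proof.
have e0 : 0 < e := ltnW he.
apply: card_eq_trans (block_balanced_card d w e0 hga) _.
apply: bal_block_card => //; first exact: maya_beta_set.
  by apply/ecore_setP => //; exact: hga.2.
exact: excess_beta_set_vacuum.
Qed.
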